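(* Let $R>0$, let $B(0,R)=\{q\in\mathbb{H}:|q|<R\}$, and let $f:B(0,R)\to\mathbb{H}$ be a $C^1$ quaternionic function. Then $f$ is S-derivable by the left (at every point of $B(0,R)$) if and only if there exist $a_k\in\mathbb{H}$ ($k\ge 0$) such that $f$ is expressible in $B(0,R)$ as an absolutely convergent power series $$f(q)=\sum_{k=0}^{\infty}q^k a_k .$$ Moreover, in this case the parallel derivatives $A,B$ and the perpendicular derivative $C$ of $f$ are given by $$A(q)=\frac{\partial f}{\partial t}(q)\quad\text{for } q\in B(0,R)\cap\mathbb{R},$$ $$B(q)=\frac{\partial f}{\partial t}(q)\quad\text{for } q\in B(0,R)\setminus\mathbb{R},$$ $$C(q)=(q-\overline{q})^{-1}\,[f(q)-f(\overline{q})]\quad\text{for } q\in B(0,R)\setminus\mathbb{R}.$$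
   Context: $\mathbb{H}$ denotes the quaternions; write $q=t+xi+yj+zk$ with $t,x,y,z\in\mathbb{R}$, and $\overline q=t-xi-yj-zk$. For $q\in\mathbb{H}\setminus\mathbb{R}$ write uniquely $q=t+r\iota$ with $t$ the real part, $r=\sqrt{x^2+y^2+z^2}>0$ and $\iota=\iota(q)=(xi+yj+zk)/r$, so $\iota^2=-1$. For $q\in\mathbb{H}\setminus\mathbb{R}$ and $h\in\mathbb{H}$ set $$h_\parallel:=\frac{h-\iota h\iota}{2},\qquad h_\perp:=\frac{h+\iota h\iota}{2},\qquad \iota=\iota(q).$$ S-derivable at a point: let $f$ be continuous and real differentiable at $q$. If $q\in\mathbb{R}$, $f$ is S-derivable by the left at $q$ if there is $A\in\mathbb{H}$ with $\lim_{h\to0}h^{-1}(f(q+h)-f(q)-hA)=0$. If $q\in\mathbb{H}\setminus\mathbb{R}$, $f$ is S-derivable by the left at $q$ if there are $B,C\in\mathbb{H}$ with $\lim_{h\to0}h^{-1}(f(q+h)-f(q)-h_\parallel B-h_\perp C)=0$. Here $h\in\mathbb{H}\setminus\{0\}$. The numbers $A$ (at real $q$) and $B$ (at non-real $q$) are called the parallel derivative at $q$, written $A(q)$, $B(q)$, and $C=C(q)$ is called the perpendicular derivative at $q$. *)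

(* Defs.v *)
From HB Require Import structures.
From mathcomp Require Import all_boot all_order all_algebra.
From mathcomp Require Import ring.
From mathcomp Require Import all_classical all_reals all_analysis.

Set Implicit Arguments.
Unset Strict Implicit.
Unset Printing Implicit Defensive.
Import Order.TTheory GRing.Theory Num.Theory.
Import numFieldNormedType.Exports.
Local Open Scope ring_scope.
Local Open Scope classical_set_scope.

(* Quat t x y z stands for t + x i + y j + z k. *)
Record quat (R : Type) := Quat { qt : R ; qx : R ; qy : R ; qz : R }.

Section QuatAlgebra.
Variable R : realType.
Implicit Types p q s : quat R.

Definition tuple_of_quat q := (qt q, qx q, qy q, qz q).
Definition quat_of_tuple (u : R * R * R * R) : quat R :=
  Quat u.1.1.1 u.1.1.2 u.1.2 u.2.

Lemma tuple_of_quatK : cancel tuple_of_quat quat_of_tuple.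
Proof. by case. Qed.

HB.instance Definition _ := Choice.copy (quat R) (can_type tuple_of_quatK).

Lemma quat_ext p q :
  qt p = qt q -> qx p = qx q -> qy p = qy q -> qz p = qz q -> p = q.
Proof. by case: p => ????; case: q => ???? /= -> -> -> ->. Qed.

Definition addq p q :=
  Quat (qt p + qt q) (qx p + qx q) (qy p + qy q) (qz p + qz q).
Definition oppq q := Quat (- qt q) (- qx q) (- qy q) (- qz q).
Definition scaleq (c : R) q := Quat (c * qt q) (c * qx q) (c * qy q) (c * qz q).
Definition mulq p q := Quat
  (qt p * qt q - qx p * qx q - qy p * qy q - qz p * qz q)
  (qt p * qx q + qx p * qt q + qy p * qz q - qz p * qy q)
  (qt p * qy q - qx p * qz q + qy p * qt q + qz p * qx q)
  (qt p * qz q + qx p * qy q - qy p * qx q + qz p * qt q).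
Definition normsq q : R := qt q ^+ 2 + qx q ^+ 2 + qy q ^+ 2 + qz q ^+ 2.
Definition conjq q := Quat (qt q) (- qx q) (- qy q) (- qz q).
Definition invq q := scaleq (normsq q)^-1 (conjq q).

Fact addqA : associative addq.
Proof. by move=> p q s; apply: quat_ext => /=; ring. Qed.
Fact addqC : commutative addq.
Proof. by move=> p q; apply: quat_ext => /=; ring. Qed.
Fact add0q : left_id (Quat 0 0 0 0) addq.
Proof. by move=> q; apply: quat_ext => /=; ring. Qed.
Fact addNq : left_inverse (Quat 0 0 0 0) oppq addq.
Proof. by move=> q; apply: quat_ext => /=; ring. Qed.
HB.instance Definition _ :=
  GRing.isZmodule.Build (quat R) addqA addqC add0q addNq.

Fact mulqA : associative mulq.
Proof. by move=> p q s; apply: quat_ext => /=; ring. Qed.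
Fact mul1q : left_id (Quat 1 0 0 0) mulq.
Proof. by move=> q; apply: quat_ext => /=; ring. Qed.
Fact mulq1 : right_id (Quat 1 0 0 0) mulq.
Proof. by move=> q; apply: quat_ext => /=; ring. Qed.
Fact mulqDl : left_distributive mulq +%R.
Proof. by move=> p q s; apply: quat_ext => /=; ring. Qed.
Fact mulqDr : right_distributive mulq +%R.
Proof. by move=> p q s; apply: quat_ext => /=; ring. Qed.
Fact oneq_neq0 : Quat 1 0 0 0 != 0 :> quat R.
Proof. by apply/eqP => -[] /eqP; rewrite oner_eq0. Qed.
HB.instance Definition _ := GRing.Zmodule_isNzRing.Build (quat R)
  mulqA mul1q mulq1 mulqDl mulqDr oneq_neq0.

Fact scaleqA (a b : R) q : scaleq a (scaleq b q) = scaleq (a * b) q.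
Proof. by apply: quat_ext => /=; ring. Qed.
Fact scale1q : left_id 1 scaleq.
Proof. by move=> q; apply: quat_ext => /=; ring. Qed.
Fact scaleqDr : right_distributive scaleq +%R.
Proof. by move=> a p q; apply: quat_ext => /=; ring. Qed.
Fact scaleqDl q : {morph scaleq^~ q : a b / a + b}.
Proof. by move=> a b; apply: quat_ext => /=; ring. Qed.
HB.instance Definition _ := GRing.Zmodule_isLmodule.Build R (quat R)
  scaleqA scale1q scaleqDr scaleqDl.

Fact scaleqAl (a : R) p q : a *: (p * q) = (a *: p) * q.
Proof. by apply: quat_ext => /=; ring. Qed.
HB.instance Definition _ := GRing.Lmodule_isLalgebra.Build R (quat R) scaleqAl.
Fact scaleqAr (a : R) p q : a *: (p * q) = p * (a *: q).
Proof. by apply: quat_ext => /=; ring. Qed.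
HB.instance Definition _ := GRing.Lalgebra_isAlgebra.Build R (quat R) scaleqAr.

Lemma normsq_ge0 q : 0 <= normsq q.
Proof. by rewrite !addr_ge0 ?sqr_ge0. Qed.

Lemma normsq_eq0 q : (normsq q == 0) = (q == 0).
Proof.
apply/eqP/eqP => [|->]; last by rewrite /normsq /= expr0n /= !addr0.
move/eqP; rewrite !paddr_eq0 ?addr_ge0 ?sqr_ge0 // !sqrf_eq0.
by move=> /andP[/andP[/andP[/eqP ? /eqP ?] /eqP ?] /eqP ?]; apply: quat_ext.
Qed.

Fact mulVq : {in [pred q | q != 0], left_inverse 1 invq *%R}.
Proof.
move=> q; rewrite inE /= -normsq_eq0 => n0.
by apply: quat_ext => /=; rewrite /normsq in n0 *; field.
Qed.
Fact mulqV : {in [pred q | q != 0], right_inverse 1 invq *%R}.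
Proof.
move=> q; rewrite inE /= -normsq_eq0 => n0.
by apply: quat_ext => /=; rewrite /normsq in n0 *; field.
Qed.
Fact unitq p q : q * p = 1 /\ p * q = 1 -> [pred q | q != 0] p.
Proof.
by move=> [+ _] /=; apply: contra_eq_neq => ->; rewrite mulr0 eq_sym oner_eq0.
Qed.
Fact invq0 : {in [predC [pred q | q != 0]], invq =1 id}.
Proof. by move=> q; rewrite !inE negbK => /eqP ->; apply: quat_ext => /=; ring. Qed.
HB.instance Definition _ :=
  GRing.NzRing_hasMulInverse.Build (quat R) mulVq mulqV unitq invq0.

Definition normq q : R := Num.sqrt (normsq q).

Fact normqD p q : normq (p + q) <= normq p + normq q.
Proof.
rewrite -[leRHS]ger0_norm ?addr_ge0 ?sqrtr_ge0 // -sqrtr_sqr ler_sqrt ?sqr_ge0 //.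
rewrite sqrrD !sqr_sqrtr ?normsq_ge0 // -sqrtrM ?normsq_ge0 //.
set dot := qt p * qt q + qx p * qx q + qy p * qy q + qz p * qz q.
have -> : normsq (p + q) = normsq p + dot *+ 2 + normsq q.
  by rewrite /normsq /dot /=; ring.
rewrite lerD2r lerD2l lerMn2r /=; apply: (le_trans (ler_norm _)).
rewrite -sqrtr_sqr ler_sqrt ?mulr_ge0 ?normsq_ge0 // -subr_ge0.
have -> : normsq p * normsq q - dot ^+ 2 =
  (qt p * qx q - qx p * qt q) ^+ 2 + (qt p * qy q - qy p * qt q) ^+ 2 +
  (qt p * qz q - qz p * qt q) ^+ 2 + (qx p * qy q - qy p * qx q) ^+ 2 +
  (qx p * qz q - qz p * qx q) ^+ 2 + (qy p * qz q - qz p * qy q) ^+ 2.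
  by rewrite /normsq /dot; ring.
by rewrite !addr_ge0 ?sqr_ge0.
Qed.

Fact normqZ (a : R) q : normq (a *: q) = `|a| * normq q.
Proof.
rewrite /normq -sqrtr_sqr -sqrtrM ?sqr_ge0 //; congr Num.sqrt.
by rewrite /normsq /=; ring.
Qed.

Fact normq_eq0 q : normq q = 0 -> q = 0.
Proof.
move/eqP; rewrite sqrtr_eq0 => n0; apply/eqP.
by rewrite -normsq_eq0 eq_le n0 normsq_ge0.
Qed.

HB.instance Definition _ :=
  Lmodule_isNormed.Build R (quat R) normqD normqZ normq_eq0.

Definition qi : quat R := Quat 0 1 0 0.
Definition qj : quat R := Quat 0 0 1 0.
Definition qk : quat R := Quat 0 0 0 1.

Definition imq q : quat R := Quat 0 (qx q) (qy q) (qz q).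

Definition is_real q : Prop := imq q = 0.

End QuatAlgebra.

Arguments qi {R}.
Arguments qj {R}.
Arguments qk {R}.

Section SDerivative.
Variable R : realType.
Implicit Types (f : quat R -> quat R) (q h A B C : quat R).

(* The imaginary unit of q; meaningful only for q not real. *)
Definition iota_of q : quat R := `|imq q|^-1 *: imq q.

Definition par q h : quat R := 2^-1 *: (h - iota_of q * h * iota_of q).
Definition perp q h : quat R := 2^-1 *: (h + iota_of q * h * iota_of q).

Definition is_sderiv_real f q A : Prop :=
  h^-1 * (f (q + h) - f q - h * A) @[h --> (0 : quat R)^'] --> (0 : quat R).

Definition is_sderiv_nonreal f q B C : Prop :=
  h^-1 * (f (q + h) - f q - par q h * B - perp q h * C)
    @[h --> (0 : quat R)^'] --> (0 : quat R).

Definition sderivable f q : Prop :=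
  [/\ {for q, continuous f}, differentiable f q,
      (is_real q -> exists A, is_sderiv_real f q A) &
      (~ is_real q -> exists B C, is_sderiv_nonreal f q B C)].

(* The directions 1, qi, qj, qk give the partial derivatives with respect to
   the real coordinates t, x, y, z. *)
Definition C1_on (U : set (quat R)) f : Prop :=
  forall v, v \in [:: 1; qi; qj; qk] -> forall q, U q ->
    derivable f q v /\ {for q, continuous (fun p => 'D_v f p)}.

Definition abs_power_series_on (U : set (quat R)) f (a : nat -> quat R) : Prop :=
  forall q, U q ->
    cvgn [series `|q ^+ k * a k|]_k /\
    [series q ^+ k * a k]_k @ \oo --> f q.

End SDerivative.

(* Main.v *)
Require Import Defs.
From HB Require Import structures.
From mathcomp Require Import all_boot all_order all_algebra.
From mathcomp Require Import ring lra.
From mathcomp Require Import all_classical all_reals all_analysis.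
Import Order.TTheory GRing.Theory Num.Theory.
Import numFieldNormedType.Exports.
Local Open Scope ring_scope.
Local Open Scope classical_set_scope.

(* Fix I with I^2 = -1. On the slice R + R I, a field of mutually commuting
   quaternions, S-derivability says that f is differentiable over the slice
   acting on the left, with derivative g = 'D_1 f, which is continuous as f is
   C^1. For w a primitive n-th root of unity in the slice, put
   W_j = (1/n) \sum_(k < n) (z/r)^k w^(-jk). Then \sum_j W_j = 1 and
   W_j (r w^j - z) = (1 - (z/r)^n) r w^j / n, so the function
   phi(s) = \sum_j W_j f(z + s (r w^j - z)) runs from phi(0) = f(z) to a
   polynomial phi(1) in z, while phi'(s) is a multiple of the mean of
   w^j g(z + s (r w^j - z)); up to the modulus of continuity of g that mean is a
   telescoping sum around a closed polygon, hence it tends to 0 as n grows. So f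
   is a uniform limit of polynomials \sum_k z^k c_k on each disc of the slice;
   averaging over roots of unity bounds the c_k, and f is a power series there.
   Its coefficients are determined by f on the real axis, hence they do not
   depend on I. Conversely, the part of (q + h)^k linear in h is
   h_par k q^(k-1) + h_perp (q - q^* )^-1 (q^k - q^*^k), because q commutes with
   h_par and q h_perp = h_perp q^*, where q^* is the conjugate of q. *)

Set Implicit Arguments.
Unset Strict Implicit.
Unset Printing Implicit Defensive.

(** * Norm and topology of the quaternions *)

Lemma normqE (R : realType) (q : quat R) : `|q| = Num.sqrt (normsq q).
Proof. by []. Qed.

Lemma normqM (R : realType) (p q : quat R) : `|p * q| = `|p| * `|q|.
Proof.
rewrite !normqE -sqrtrM ?normsq_ge0 //; congr Num.sqrt.
by rewrite /normsq /=; ring.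
Qed.

Lemma normq1 (R : realType) : `|1 : quat R| = 1.
Proof. by rewrite normqE /normsq /= expr1n expr0n /= !addr0 sqrtr1. Qed.

Lemma normqX (R : realType) (q : quat R) n : `|q ^+ n| = `|q| ^+ n.
Proof. by elim: n => [|n IH]; rewrite ?normq1 // !exprS normqM IH. Qed.

Lemma unitqE (R : realType) (q : quat R) : (q \is a GRing.unit) = (q != 0).
Proof. by []. Qed.

Lemma normqV (R : realType) (q : quat R) : `|q^-1| = `|q|^-1.
Proof.
have [->|q0] := eqVneq q 0; first by rewrite invr0 normr0 invr0.
apply: (mulfI (_ : `|q| != 0)); first by rewrite normr_eq0.
by rewrite -normqM mulrV ?unitqE // normq1 divff // normr_eq0.
Qed.

Lemma normq_conj (R : realType) (q : quat R) : `|conjq q| = `|q|.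
Proof. by rewrite !normqE; congr Num.sqrt; rewrite /normsq /=; ring. Qed.

Lemma mulq_conj (R : realType) (q : quat R) : conjq q * q = (`|q| ^+ 2)%:A.
Proof.
rewrite normqE sqr_sqrtr ?normsq_ge0 //.
by apply: quat_ext; rewrite /normsq /=; ring.
Qed.

Lemma coord_le_normq (R : realType) (q : quat R) :
  [/\ `|qt q| <= `|q|, `|qx q| <= `|q|, `|qy q| <= `|q| & `|qz q| <= `|q|].
Proof.
by split; rewrite normqE -sqrtr_sqr ler_sqrt ?normsq_ge0 // /normsq;
  have := (sqr_ge0 (qt q), sqr_ge0 (qx q), sqr_ge0 (qy q), sqr_ge0 (qz q));
  move=> [[[? ?] ?] ?]; lra.
Qed.

Lemma normq_le_coord (R : realType) (q : quat R) :
  `|q| <= `|qt q| + `|qx q| + `|qy q| + `|qz q|.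
Proof.
rewrite -[leRHS]ger0_norm ?addr_ge0 // -sqrtr_sqr normqE ler_sqrt ?sqr_ge0 //.
rewrite /normsq -(real_normK (num_real (qt q))) -(real_normK (num_real (qx q))).
rewrite -(real_normK (num_real (qy q))) -(real_normK (num_real (qz q))).
have := (normr_ge0 (qt q), normr_ge0 (qx q), normr_ge0 (qy q), normr_ge0 (qz q)).
by move=> [[[? ?] ?] ?]; nra.
Qed.

Lemma quat_of_tuple_continuous (R : realType) :
  continuous (@quat_of_tuple R).
Proof.
move=> u; apply/cvgrPdist_lt => e e0.
have e4 : 0 < e / 4 by apply: divr_gt0.
near=> v.
have : ball u (e / 4) v by near: v; exact: (nbhsx_ballx u _ e4).
move=> [[[/= h1 h2] h3] h4].
apply: (le_lt_trans (normq_le_coord _)).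
move: h1 h2 h3 h4; rewrite /ball/= => h1 h2 h3 h4.
have -> : e = e / 4 + e / 4 + e / 4 + e / 4 by lra.
by rewrite !ltrD.
Unshelve. all: by end_near. Qed.

Lemma compact_quat_ball (R : realType) (r : R) :
  compact [set q : quat R | `|q| <= r].
Proof.
pose B := `[- r, r] `*` `[- r, r] `*` `[- r, r] `*` `[- r, r].
have cB : compact B by do 3?apply: compact_setX; exact: segment_compact.
have cI : compact (@quat_of_tuple R @` B).
  apply: continuous_compact cB; apply: continuous_subspaceT.
  exact: quat_of_tuple_continuous.
apply: (subclosed_compact _ cI).
  have -> : [set q : quat R | `|q| <= r] = (fun q : quat R => `|q|) @^-1` [set x | x <= r] by [].
  by apply: closed_comp; [move=> *; exact: norm_continuous|exact: closed_le].
move=> q /= qr; exists (tuple_of_quat q); last exact: tuple_of_quatK.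
have [h1 h2 h3 h4] := coord_le_normq q.
by rewrite /B /=; do !split; rewrite /= in_itv /= -ler_norml (le_trans _ qr).
Qed.

Lemma cvg_quat_coord (R : realType) T (F : set_system T) {FF : Filter F}
    (g : T -> quat R) (q : quat R) :
  qt (g x) @[x --> F] --> qt q -> qx (g x) @[x --> F] --> qx q ->
  qy (g x) @[x --> F] --> qy q -> qz (g x) @[x --> F] --> qz q ->
  g @ F --> q.
Proof.
move=> ht hx hy hz.
have -> : g = @quat_of_tuple R \o (fun x => (qt (g x), qx (g x), qy (g x), qz (g x))).
  by apply/funext => x /=; case: (g x).
have -> : q = @quat_of_tuple R (qt q, qx q, qy q, qz q) by case: (q).
apply: continuous_cvg; first exact: quat_of_tuple_continuous.
exact: (cvg_pair (cvg_pair (cvg_pair ht hx) hy) hz).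
Qed.

Lemma quat_complete (R : realType) (F : set_system (quat R)) :
  ProperFilter F -> cauchy F -> cvg F.
Proof.
move=> FF cF.
have cc (c : quat R -> R) : (forall p q, `|c p - c q| <= `|p - q|) -> cvg (c @ F).
  move=> cl; apply: R_complete; apply/cauchy_exP.
  move=> _/posnumP[e].
  have /cauchyP /(_ e%:num) [//|p Fp] := cF.
  exists (c p); suff : F [set q | ball (c p) e%:num (c q)] by [].
  apply: filterS Fp => q; rewrite -ball_normE /ball/= => pq.
  exact: le_lt_trans (cl p q) pq.
have ct (p q : quat R) : [/\ `|qt p - qt q| <= `|p - q|, `|qx p - qx q| <= `|p - q|,
    `|qy p - qy q| <= `|p - q| & `|qz p - qz q| <= `|p - q|].
  exact: (coord_le_normq (p - q)).
have /cvg_ex[t ht] := cc (@qt R) (fun p q => let: And4 h _ _ _ := ct p q in h).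
have /cvg_ex[x hx] := cc (@qx R) (fun p q => let: And4 _ h _ _ := ct p q in h).
have /cvg_ex[y hy] := cc (@qy R) (fun p q => let: And4 _ _ h _ := ct p q in h).
have /cvg_ex[z hz] := cc (@qz R) (fun p q => let: And4 _ _ _ h := ct p q in h).
apply/cvg_ex; exists (Quat t x y z).
exact: (@cvg_quat_coord R _ F _ id).
Qed.

HB.instance Definition _ (R : realType) :=
  Uniform_isComplete.Build (quat R) (@quat_complete R).

Lemma is_derive_lipschitz_linear (R : realType) (V W : normedModType R)
    (L : V -> W) (K : R) (g : R -> V) (s : R) (dg : V) :
  (forall x y, L (x - y) = L x - L y) -> (forall a x, L (a *: x) = a *: L x) ->
  (forall x, `|L x| <= K * `|x|) ->
  is_derive s 1 g dg -> is_derive s 1 (L \o g) (L dg).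
Proof.
move=> LB LZ LK [dg1 dg2].
have Lc : continuous L.
  move=> x; apply/cvgrPdist_lt => e e0; near=> y.
  rewrite -LB (le_lt_trans (LK _)) //.
  have K1 : 0 < `|K| + 1 by rewrite ltr_pwDr.
  apply: (@le_lt_trans _ _ ((`|K| + 1) * `|x - y|)).
    by rewrite ler_wpM2r // (le_trans (ler_norm _)) // lerDl.
  rewrite -ltr_pdivlMl //; near: y; apply: cvgr_dist_lt => //.
  by rewrite mulr_gt0 // invr_gt0.
have cL : h^-1 *: ((L \o g) (h *: 1 + s) - (L \o g) s) @[h --> 0^'] --> L dg.
  have -> : (fun h => h^-1 *: ((L \o g) (h *: 1 + s) - (L \o g) s)) =
            L \o (fun h => h^-1 *: (g (h *: 1 + s) - g s)).
    by apply/funext => h /=; rewrite LZ LB.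
  apply: continuous_cvg; first exact: Lc.
  by rewrite -dg2; exact: dg1.
by apply: DeriveDef; [exact: cvgP cL|exact: cvg_lim cL].
Unshelve. all: by end_near. Qed.

Lemma is_derive_mulql (R : realType) (w : quat R) (g : R -> quat R) (s : R) (dg : quat R) :
  is_derive s 1 g dg -> is_derive s 1 (fun x : R => w * g x) (w * dg).
Proof.
apply: (@is_derive_lipschitz_linear _ _ _ ( *%R w) `|w|) => [x y|a x|x].
- by rewrite mulrBr.
- by rewrite -scalerAr.
- by rewrite normqM.
Qed.

Lemma normq_mean_value (R : realType) (g dg : R -> quat R) (K : R) :
  (forall s : R, s \in `[0, 1]%R -> is_derive s 1 g (dg s)) ->
  (forall s, s \in `]0, 1[%R -> `|dg s| <= K) ->
  `|g 1 - g 0| <= K.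
Proof.
move=> gd dK; set v := g 1 - g 0.
(* The scalar product with v reduces the inequality to the real mean value
   theorem. *)
pose l (s : R) := qt (conjq v * g s).
have dl (s : R) : s \in `[0, 1]%R -> is_derive s 1 l (qt (conjq v * dg s)).
  move=> /gd; apply: (@is_derive_lipschitz_linear _ _ _
    (fun x => qt (conjq v * x)) `|v|) => [x y|a x|x].
  - by rewrite mulrBr.
  - by rewrite -scalerAr.
  - by rewrite -(normq_conj v) -normqM; have [] := coord_le_normq (conjq v * x).
have dlo (s : R) : s \in `]0, 1[%R -> is_derive s 1 l (qt (conjq v * dg s)).
  by move=> /subset_itv_oo_cc; exact: dl.
have lc : {within `[0, 1], continuous l}.
  by apply: derivable_within_continuous => s /dl[].
have [s s01] := MVT ltr01 dlo lc.
rewrite subr0 mulr1.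
have -> : l 1 - l 0 = `|v| ^+ 2.
  rewrite -[RHS]mulr1 -[RHS]/(qt ((`|v| ^+ 2)%:A)) -mulq_conj.
  by rewrite [in RHS]/v mulrBr.
move=> vE; have [->|v0] := eqVneq v 0.
  by rewrite normr0 (le_trans _ (dK _ s01)).
rewrite -(@ler_pM2l _ `|v|) ?normr_gt0 // -expr2 vE.
apply: (le_trans (ler_norm _)).
have [+ _ _ _] := coord_le_normq (conjq v * dg s).
move/le_trans; apply; rewrite normqM normq_conj ler_wpM2l //; exact: dK.
Qed.

Lemma is_derive_line (R : realType) (V W : normedModType R) (f : V -> W)
    (p v : V) (s : R) (d : W) :
  is_derive (p + s *: v) v f d -> is_derive s 1 (fun x => f (p + x *: v)) d.
Proof.
move=> [d1 d2].
suff cd : h^-1 *: (f (p + (h *: 1 + s) *: v) - f (p + s *: v)) @[h --> 0^'] --> d.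
  by apply: DeriveDef; [exact: cvgP cd|exact: cvg_lim cd].
move: d1; rewrite /derivable => d1; rewrite -d2 /derive.
have E : (fun h => h^-1 *: (f (p + (h *: 1 + s) *: v) - f (p + s *: v))) =
   (fun h => h^-1 *: ((f \o shift (p + s *: v)) (h *: v) - f (p + s *: v))).
  apply/funext => h /=; congr (_ *: (f _ - _)).
  by rewrite scalerDl addrCA; congr (_ *: _ + _); rewrite [_ *: _]mulr1.
by rewrite E; exact: d1.
Qed.

Lemma compact_uniform_cont (R : realType) (V W : normedModType R) (K : set V)
    (g : V -> W) (e : R) :
  compact K -> (forall x, K x -> {for x, continuous g}) -> 0 < e ->
  exists2 d, 0 < d & forall x y, K x -> `|x - y| < d -> `|g x - g y| < e.
Proof.
move=> /compact_near_coveringP cK gc e0.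
have e20 : 0 < e / 2 by rewrite divr_gt0.
have : \forall d \near 0^'+, K `<=` (fun x => forall y, `|x - y| < d -> `|g x - g y| < e).
  apply: cK => x Kx.
  have := gc x Kx => /cvgrPdist_lt /(_ _ e20) /nbhs_ballP [d /= d0 gd].
  exists (ball x (d / 2), [set t | t <= d / 2]) => /=.
    split; first by apply: nbhsx_ballx; rewrite divr_gt0.
    by apply: nbhs_right_le; rewrite divr_gt0.
  move=> [x' t] /= [xx' td] y x'y.
  have xd : ball x d x' by apply: le_ball xx'; rewrite ler_pdivrMr // ler_peMr ?ler1n // ltW.
  have yd : ball x d y.
    rewrite [d]splitr; apply: ball_triangle xx' _.
    by rewrite -ball_normE /=; exact: lt_le_trans td.
  rewrite (splitr e); apply: (le_lt_trans (ler_distD (g x) _ _)).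
  by rewrite ltrD //; [rewrite distrC|]; exact: gd.
move=> h; have h2 : \forall d \near (0 : R)^'+, 0 < d by exact: nbhs_right_gt.
have [d [d0 dK]] := filter_ex (filterI h2 h).
by exists d => // x y Kx; exact: dK.
Qed.

(** * Directional derivatives of S-derivable functions *)

Lemma cvg0_dnbhsP (R : realType) (V W : normedModType R) (g : V -> W) :
  g k @[k --> (0 : V)^'] --> (0 : W) <->
  forall e, 0 < e -> exists2 d, 0 < d &
    forall k, k != 0 -> `|k| < d -> `|g k| < e.
Proof.
split=> [/cvgr0Pnorm_lt h e /h|h].
  move=> /nbhs_ballP[d /= d0 dg]; exists d => // k k0 kd; apply: dg => //.
  by rewrite -ball_normE /= sub0r normrN.
apply/cvgr0Pnorm_lt => e /h [d d0 dg]; apply/nbhs_ballP; exists d => //= k.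
by rewrite -ball_normE /= sub0r normrN => kd k0; exact: dg.
Qed.

Lemma is_derive_of_quotient (R : realType) (f L : quat R -> quat R) (q h : quat R) :
  (forall (t : R) k, L (t *: k) = t *: L k) ->
  k^-1 * (f (q + k) - f q - L k) @[k --> (0 : quat R)^'] --> (0 : quat R) ->
  is_derive q h f (L h).
Proof.
move=> LZ /cvg0_dnbhsP fL.
have [->|h0] := eqVneq h 0.
  have -> : L 0 = 0 by have := LZ 0 0; rewrite !scale0r.
  by apply: DeriveDef; [exact: derivable0|exact: derive0].
have hn0 : 0 < `|h| by rewrite normr_gt0.
suff cL : t^-1 *: (f (t *: h + q) - f q) @[t --> (0 : R)^'] --> L h.
  by apply: DeriveDef; [exact: cvgP cL|exact: cvg_lim cL].
apply/subr_cvg0; apply/cvg0_dnbhsP => e e0.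
have [|d d0 dL] := fL (e / `|h|); first by rewrite divr_gt0.
exists (d / `|h|) => [|t t0 td]; first by rewrite divr_gt0.
have := dL (t *: h); rewrite scaler_eq0 negb_or t0 h0 normrZ -ltr_pdivlMr //.
move=> /(_ isT td); rewrite LZ ltr_pdivlMr // => lte.
have -> : t^-1 *: (f (t *: h + q) - f q) - L h =
          t^-1 *: (f (q + t *: h) - f q - t *: L h).
  by rewrite [in RHS]scalerBr scalerA mulVf // scale1r [_ *: h + _]addrC.
apply: le_lt_trans lte; rewrite normrZ normqM normqV normrZ normfV invfM -!mulrA.
by rewrite ler_wpM2l ?invr_ge0 // mulrC mulfK ?gt_eqF.
Qed.

Lemma is_realP (R : realType) (q : quat R) : is_real q <-> q = (qt q)%:A.
Proof.
split=> [|->]; last by apply: quat_ext => /=; rewrite ?mulr0.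
by case: q => t x y z [-> -> ->]; apply: quat_ext => /=; ring.
Qed.

Lemma quat_decomp (R : realType) (q : quat R) :
  q = (qt q)%:A + `|imq q| *: iota_of q.
Proof.
rewrite /iota_of scalerA; have [i0|i0] := eqVneq (imq q) 0.
  by rewrite i0 scaler0 addr0; apply/is_realP.
rewrite divff ?normr_eq0 // scale1r.
by apply: quat_ext => /=; ring.
Qed.

Lemma iota_sqr (R : realType) (q : quat R) :
  ~ is_real q -> iota_of q * iota_of q = -1.
Proof.
move=> /eqP i0; rewrite /iota_of -scalerAr -scalerAl scalerA.
rewrite -invfM -expr2 normqE sqr_sqrtr ?normsq_ge0 //.
move: i0; rewrite -normsq_eq0 => n0.
by apply: quat_ext => /=; rewrite /normsq /= ?expr0n ?add0r in n0 *; field.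
Qed.

Lemma comm_iota (R : realType) (q h : quat R) :
  GRing.comm h q -> GRing.comm h (iota_of q).
Proof.
move=> hq; rewrite /iota_of /GRing.comm -scalerAr -scalerAl; congr (_ *: _).
have -> : imq q = q - (qt q)%:A by apply: quat_ext => /=; ring.
by rewrite mulrBr mulrBl hq -!scalerAr -!scalerAl mulr1 mul1r.
Qed.

Lemma par_comm (R : realType) (q h : quat R) :
  ~ is_real q -> GRing.comm h q -> par q h = h.
Proof.
move=> qr /comm_iota hi; rewrite /par -hi -mulrA iota_sqr // mulrN1 opprK.
by apply: quat_ext => /=; field.
Qed.

Lemma par_perp (R : realType) (q h : quat R) : par q h + perp q h = h.
Proof.
rewrite /par /perp; move: (iota_of q) => I.
by apply: quat_ext => /=; field.
Qed.

Lemma perp_comm (R : realType) (q h : quat R) :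
  ~ is_real q -> GRing.comm h q -> perp q h = 0.
Proof.
by move=> qr hq; apply: (addrI (par q h)); rewrite par_perp addr0 par_comm.
Qed.

Lemma parZ (R : realType) (q : quat R) (t : R) h : par q (t *: h) = t *: par q h.
Proof.
by rewrite /par; move: (iota_of q) => I; apply: quat_ext => /=; ring.
Qed.

Lemma perpZ (R : realType) (q : quat R) (t : R) h : perp q (t *: h) = t *: perp q h.
Proof.
by rewrite /perp; move: (iota_of q) => I; apply: quat_ext => /=; ring.
Qed.

Lemma is_derive_sderiv_real (R : realType) (f : quat R -> quat R) (q A h : quat R) :
  is_sderiv_real f q A -> is_derive q h f (h * A).
Proof.
move=> fA; apply: (@is_derive_of_quotient _ _ (fun h => h * A)) => // t k.
by rewrite scalerAl.
Qed.

Lemma is_derive_sderiv_nonreal (R : realType) (f : quat R -> quat R)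
    (q B C h : quat R) :
  is_sderiv_nonreal f q B C -> is_derive q h f (par q h * B + perp q h * C).
Proof.
move=> fBC; apply: (@is_derive_of_quotient _ _
  (fun h => par q h * B + perp q h * C)).
  by move=> t k; rewrite parZ perpZ -!scalerAl scalerDr.
by under eq_fun do rewrite opprD addrA.
Qed.

Lemma sderiv_real_val (R : realType) (f : quat R -> quat R) (q A : quat R) :
  is_sderiv_real f q A -> A = 'D_1 f q.
Proof. by move=> /(is_derive_sderiv_real 1) [_ ->]; rewrite mul1r. Qed.

Lemma sderiv_nonreal_par (R : realType) (f : quat R -> quat R) (q B C : quat R) :
  ~ is_real q -> is_sderiv_nonreal f q B C -> B = 'D_1 f q.
Proof.
move=> qr /(is_derive_sderiv_nonreal 1) [_ ->].
by rewrite par_comm ?perp_comm ?mul0r ?addr0 ?mul1r //; exact/commr_sym/commr1.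
Qed.

Lemma is_derive_comm (R : realType) (f : quat R -> quat R) (q h : quat R) :
  sderivable f q -> GRing.comm h q -> is_derive q h f (h * 'D_1 f q).
Proof.
move=> [_ _ fr fnr] hq; have [qr|qr] := pselect (is_real q).
  have [A fA] := fr qr; rewrite -(sderiv_real_val fA).
  exact: is_derive_sderiv_real.
have [B [C fBC]] := fnr qr; rewrite -(sderiv_nonreal_par qr fBC).
have := is_derive_sderiv_nonreal h fBC.
by rewrite par_comm ?perp_comm ?mul0r ?addr0.
Qed.

(** * Slices and their roots of unity *)

Lemma slice_decomp (R : realType) (I p : quat R) :
  I * I = -1 -> GRing.comm p I -> exists a b : R, p = a *: 1 + b *: I.
Proof.
case: I => t u v w; case: p => a x y z II pI.
have /= := congr1 (@qt R) II; have /= := congr1 (@qx R) II.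
have /= := congr1 (@qy R) II; have /= := congr1 (@qz R) II.
move=> tw tv tu tt.
have t0 : t = 0.
  have [//|t0] := eqVneq t 0; exfalso.
  have u0 : u = 0 by apply: (mulfI t0); lra.
  have v0 : v = 0 by apply: (mulfI t0); lra.
  have w0 : w = 0 by apply: (mulfI t0); lra.
  by have := sqr_ge0 t; subst u v w; rewrite expr2; lra.
have /= := congr1 (@qx R) pI; have /= := congr1 (@qy R) pI.
have /= := congr1 (@qz R) pI => {tu tv tw II pI}; subst t => cz cy cx.
have n1 : u * u + v * v + w * w = 1 by lra.
exists a, (x * u + y * v + z * w); apply: quat_ext => /=.
- by ring.
- transitivity (x * (u * u + v * v + w * w)); first by rewrite n1 mulr1.
  have xv : x * v = y * u by lra.
  have xw : x * w = z * u by lra.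
  transitivity (x * u * u + x * v * v + x * w * w); first by ring.
  by rewrite xv xw; ring.
- transitivity (y * (u * u + v * v + w * w)); first by rewrite n1 mulr1.
  have xv : y * u = x * v by lra.
  have xw : y * w = z * v by lra.
  transitivity (y * u * u + y * v * v + y * w * w); first by ring.
  by rewrite xv xw; ring.
- transitivity (z * (u * u + v * v + w * w)); first by rewrite n1 mulr1.
  have xv : z * u = x * w by lra.
  have xw : z * v = y * w by lra.
  transitivity (z * u * u + z * v * v + z * w * w); first by ring.
  by rewrite xv xw; ring.
Qed.

Lemma comm_scale (R : realType) (p q : quat R) (a : R) :
  GRing.comm p q -> GRing.comm p (a *: q).
Proof. by rewrite /GRing.comm -scalerAr -scalerAl => ->. Qed.

Lemma slice_comm (R : realType) (I p q : quat R) :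
  I * I = -1 -> GRing.comm p I -> GRing.comm q I -> GRing.comm p q.
Proof.
move=> II pI qI; have [a [b ->]] := slice_decomp II qI.
by apply: commrD; apply: comm_scale => //; exact: commr1.
Qed.

Definition slice_exp (R : realType) (I : quat R) (x : R) : quat R :=
  cos x *: 1 + sin x *: I.

Lemma slice_expD (R : realType) (I : quat R) (x y : R) :
  I * I = -1 -> slice_exp I (x + y) = slice_exp I x * slice_exp I y.
Proof.
move=> II; rewrite /slice_exp cosD sinD mulrDl !mulrDr.
rewrite -!scalerAl -!scalerAr !mulr1 !mul1r II.
move: (cos x) (cos y) (sin x) (sin y) => a b c d.
by apply: quat_ext => /=; ring.
Qed.

Lemma slice_expX (R : realType) (I : quat R) (x : R) n :
  I * I = -1 -> slice_exp I x ^+ n = slice_exp I (n%:R * x).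
Proof.
move=> II; elim: n => [|n IH].
  by rewrite mul0r /slice_exp cos0 sin0; apply: quat_ext => /=; ring.
by rewrite exprS IH -slice_expD // -natr1 mulrDl mul1r addrC.
Qed.

Lemma cos_lt1 (R : realType) (x : R) : 0 < x < pi *+ 2 -> cos x < 1.
Proof.
move=> /andP[x0 x2]; have x2E : x = (x / 2) *+ 2 by rewrite -mulr_natr divfK.
have s0 : 0 < sin (x / 2).
  apply: sin_gt0_pi; rewrite divr_gt0 //= ltr_pdivrMr //.
  by rewrite mulr_natr.
move: x2E s0; move: (x / 2) => y -> s0.
have := cos2Dsin2 y; have := exprn_gt0 2 s0; rewrite cos_mulr2n -mulr_natr; lra.
Qed.

Lemma slice_exp_eq1 (R : realType) (I : quat R) (x : R) :
  I * I = -1 -> slice_exp I x = 1 -> cos x = 1.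
Proof.
move=> II; rewrite /slice_exp => E.
have : (cos x - 1) *: 1 = - sin x *: I.
  apply/eqP; rewrite -subr_eq0; apply/eqP.
  have := subrr (1 : quat R); rewrite -{1}E => <-.
  by apply: quat_ext => /=; ring.
move=> h; have h2 : ((cos x - 1) ^+ 2 + sin x ^+ 2) *: (1 : quat R) = 0.
  have : ((cos x - 1) *: 1) * ((cos x - 1) *: 1) = (- sin x *: I) * (- sin x *: I) by rewrite h.
  rewrite -!scalerAl -!scalerAr II mulr1 => hh.
  have := subrr ((cos x - 1) *: ((cos x - 1) *: (1 : quat R))); rewrite {2}hh => <-.
  by apply: quat_ext => /=; ring.
have /= := congr1 (@qt R) h2; rewrite mulr1 => /eqP.
rewrite paddr_eq0 ?sqr_ge0 // sqrf_eq0 subr_eq0 => /andP[/eqP //].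
Qed.

Lemma slice_root_of_unity (R : realType) (I : quat R) (d : R) :
  I * I = -1 -> 0 < d -> exists n0, forall n, (n0 <= n)%N ->
  exists w : quat R, [/\ GRing.comm w I, `|w| = 1, w ^+ n = 1,
    forall k, (0 < k < n)%N -> w ^+ k != 1 & `|w - 1| < d].
Proof.
move=> II d0.
have Ec : {for 0, continuous (slice_exp I)}.
  move=> /=; rewrite /slice_exp; apply: cvgD.
    by apply: cvgZl; exact: continuous_cos.
  by apply: cvgZl; exact: continuous_sin.
have E0 : slice_exp I 0 = 1.
  by rewrite /slice_exp cos0 sin0; apply: quat_ext => /=; ring.
have /cvgrPdist_lt /(_ d d0) /nbhs_ballP [t /= t0 Et] := Ec.
exists (Num.truncn (pi *+ 2 / t)).+2 => n nn.
have n0 : (0 < n)%N by apply: leq_trans nn.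
have nR : 0 < n%:R :> R by rewrite ltr0n.
have p0 : 0 < pi *+ 2 :> R by rewrite mulrn_wgt0 // pi_gt0.
exists (slice_exp I (pi *+ 2 / n%:R)).
have wn : slice_exp I (pi *+ 2 / n%:R) ^+ n = 1.
  rewrite slice_expX // mulrC divfK ?gt_eqF // /slice_exp cos2pi sin2pi.
  by apply: quat_ext => /=; ring.
split=> //.
- rewrite /slice_exp; apply/commr_sym; apply: commrD; apply: comm_scale => //.
  exact: commr1.
- by apply/eqP; rewrite -(@pexpr_eq1 _ _ n) ?normr_ge0 // -normqX wn normq1.
- move=> k /andP[k0 kn]; apply/eqP; rewrite slice_expX // => /(slice_exp_eq1 II).
  apply/eqP; rewrite lt_eqF // cos_lt1 // mulr_gt0 ?ltr0n ?divr_gt0 //=.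
  by rewrite mulrC -mulrA gtr_pMr // mulrC ltr_pdivrMr // mul1r ltr_nat.
- rewrite -E0 -normrN opprB; apply: Et => /=.
  rewrite -ball_normE /= sub0r normrN ger0_norm ?divr_ge0 // ?ltW //.
  rewrite ltr_pdivrMr // mulrC -ltr_pdivrMr //.
  apply: (lt_le_trans (truncnS_gt _)); rewrite ler_nat.
  exact: ltnW.
Qed.

Lemma sum_root_of_unity (R : realType) (x : quat R) n :
  x ^+ n = 1 -> x != 1 -> \sum_(j < n) x ^+ j = 0.
Proof.
move=> xn x1; have := subrX1 x n; rewrite xn subrr => /esym/eqP h.
apply: (@mulrI _ (x - 1)); first by rewrite unitqE subr_eq0.
by rewrite mulr0; apply/eqP.
Qed.

(** * Polynomial approximation on a slice *)

(* g plays the role of the complex derivative of f on the closed disc of radius r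
   of the slice R + R I. *)
Definition slice_derivable (R : realType) (I : quat R) (r : R)
    (f g : quat R -> quat R) : Prop :=
  forall q h : quat R, `|q| <= r -> GRing.comm q I -> GRing.comm h I ->
    is_derive q h f (h * g q).

Lemma normq_convex (R : realType) (p q : quat R) (r s : R) :
  `|p| <= r -> `|q| <= r -> 0 <= s <= 1 -> `|p + s *: (q - p)| <= r.
Proof.
move=> pr qr /andP[s0 s1].
have -> : p + s *: (q - p) = (1 - s) *: p + s *: q by apply: quat_ext => /=; ring.
apply: (le_trans (ler_normD _ _)); rewrite !normrZ !ger0_norm ?subr_ge0 //.
have -> : r = (1 - s) * r + s * r by ring.
by rewrite lerD // ler_wpM2l // subr_ge0.
Qed.

Lemma slice_increment (R : realType) (I : quat R) (r e : R)
    (f g : quat R -> quat R) (p q : quat R) :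
  slice_derivable I r f g -> `|p| <= r -> `|q| <= r ->
  GRing.comm p I -> GRing.comm q I ->
  (forall s, 0 <= s <= 1 -> `|g p - g (p + s *: (q - p))| <= e) ->
  `|f q - f p - (q - p) * g p| <= `|q - p| * e.
Proof.
move=> fg pr qr pI qI ge; set v := q - p.
have vI : GRing.comm v I by apply/commr_sym; apply: commrB; apply/commr_sym.
pose F (s : R) := f (p + s *: v) - s *: (v * g p).
have -> : f q - f p - v * g p = F 1 - F 0.
  rewrite /F !scale1r !scale0r subr0 addr0 (_ : p + v = q); last first.
    by rewrite /v addrC subrK.
  by rewrite addrAC.
apply: (@normq_mean_value _ F (fun s => v * g (p + s *: v) - v * g p)).
  move=> s; rewrite in_itv /= => s01.
  apply: is_deriveB.
    apply: is_derive_line; apply: fg => //; first exact: normq_convex.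
    by apply/commr_sym; apply: commrD; [|apply: comm_scale]; apply/commr_sym.
  have := @is_derive_line _ _ _ id 0 (v * g p) s (v * g p) (is_derive_id _ _).
  by under eq_fun do rewrite /= add0r.
move=> s; rewrite in_itv /= => /andP[s0 s1].
rewrite -mulrBr normqM ler_wpM2l // distrC; apply: ge.
by rewrite !ltW.
Qed.

Lemma weight_sum (R : realType) (w : quat R) n (x : quat R) :
  (0 < n)%N -> w ^+ n = 1 -> (forall k, (0 < k < n)%N -> w ^+ k != 1) ->
  GRing.comm x w ->
  \sum_(j < n) \sum_(k < n) (x * w ^+ j) ^+ k = n%:R.
Proof.
move=> n0 wn wk xw; rewrite exchange_big /=.
have E (k : 'I_n) : \sum_(j < n) (x * w ^+ j) ^+ k =
    x ^+ k * \sum_(j < n) (w ^+ k) ^+ j.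
  rewrite mulr_sumr; apply: eq_bigr => j _.
  by rewrite exprMn_comm -?exprM 1?mulnC //; exact: commrX.
rewrite (bigD1 (Ordinal n0)) //= [X in _ + X]big1 ?addr0 => [|k k0].
  by rewrite (eq_bigr (fun _ => 1)) ?sumr_const ?card_ord.
rewrite E sum_root_of_unity ?mulr0 // -?exprM 1?mulnC ?exprM ?wn ?expr1n //.
by apply: wk; rewrite ltn_ord andbT lt0n.
Qed.

(* The points P_j = z + s (r w^j - z) form a closed polygon with edges
   P_(j+1) - P_j = s r (w - 1) w^j, so the differences f P_(j+1) - f P_j sum
   to 0. *)
Lemma circle_sum_bound (R : realType) (I : quat R) (r e s : R)
    (f g : quat R -> quat R) (z w : quat R) n :
  slice_derivable I r f g -> 0 < r -> `|z| <= r -> GRing.comm z I ->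
  GRing.comm w I -> `|w| = 1 -> w ^+ n = 1 -> w != 1 -> 0 < s <= 1 ->
  (forall p q : quat R, `|p| <= r -> `|p - q| <= r * `|w - 1| -> `|g p - g q| <= e) ->
  `|\sum_(j < n) w ^+ j * g (z + s *: (r *: w ^+ j - z))| <= n%:R * e.
Proof.
move=> fg r0 zr zI wI w1 wn wn1 /andP[s0 s1] ge.
pose P j := z + s *: (r *: w ^+ j - z).
pose c := (s * r) *: (w - 1).
have c0 : 0 < `|c|.
  by rewrite normr_gt0 scaler_eq0 negb_or mulf_neq0 ?gt_eqF //= subr_eq0.
have PB j : P j.+1 - P j = c * w ^+ j.
  rewrite /P /c exprS; move: (w ^+ j) => v; apply: quat_ext => /=; ring.
have wjr j : `|r *: w ^+ j| <= r by rewrite normrZ gtr0_norm // normqX w1 expr1n mulr1.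
have Pr j : `|P j| <= r by apply: normq_convex => //; rewrite ltW.
have wjI j : GRing.comm (r *: w ^+ j) I.
  by apply/commr_sym; apply: comm_scale; apply: commrX; exact/commr_sym.
have PI j : GRing.comm (P j) I.
  apply/commr_sym; apply: commrD; first exact/commr_sym.
  by apply: comm_scale; apply: commrB; apply/commr_sym.
have nc j : `|P j.+1 - P j| = `|c|.
  by rewrite PB normqM normqX w1 expr1n mulr1.
have ncr : `|c| <= r * `|w - 1|.
  rewrite normrZ gtr0_norm ?mulr_gt0 // ler_wpM2r // ger_pMl //.
have inc j : `|f (P j.+1) - f (P j) - (P j.+1 - P j) * g (P j)| <= `|c| * e.
  rewrite -(nc j); apply: (slice_increment fg (Pr j) (Pr _) (PI j) (PI _)).
  move=> t /andP[t0 t1]; apply: ge => //.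
  rewrite opprD addNKr normrN normrZ nc ger0_norm //.
  by apply: le_trans ncr; rewrite ger_pMl.
have tel : \sum_(j < n) (f (P j.+1) - f (P j)) = 0.
  have := @telescope_sumr _ 0 n (fun j => f (P j)) (leq0n n).
  by rewrite big_mkord => ->; rewrite /P wn expr0 subrr.
rewrite -(ler_pM2l c0) -normqM.
have -> : c * (\sum_(j < n) w ^+ j * g (z + s *: (r *: w ^+ j - z))) =
    - \sum_(j < n) (f (P j.+1) - f (P j) - (P j.+1 - P j) * g (P j)).
  rewrite sumrB tel sub0r opprK mulr_sumr.
  by apply: eq_bigr => j _; rewrite PB mulrA.
rewrite normrN (le_trans (ler_norm_sum _ _ _)) //.
apply: (@le_trans _ _ (\sum_(j < n) (`|c| * e))).
  by apply: ler_sum => j _; exact: inc.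
by rewrite sumr_const card_ord -[leLHS]mulr_natl mulrCA lexx.
Qed.

Lemma slice_poly_approx (R : realType) (I : quat R) (r e : R)
    (f g : quat R -> quat R) :
  I * I = -1 -> 0 < r -> slice_derivable I r f g ->
  (forall q : quat R, `|q| <= r -> {for q, continuous g}) -> 0 < e ->
  exists n (c : nat -> quat R), forall z : quat R,
    `|z| <= r -> GRing.comm z I -> `|f z - \sum_(k < n) z ^+ k * c k| <= e.
Proof.
move=> II r0 fg gc e0.
pose e' := e / (2 * r).
have e'0 : 0 < e' by rewrite divr_gt0 // mulr_gt0.
have [d d0 gd] := compact_uniform_cont (@compact_quat_ball R r) gc e'0.
have [|N wN] := slice_root_of_unity II (d := d / r); first by rewrite divr_gt0.
have [w [wI w1 wn wk wd]] := wN N.+2 (leqW (leqnSn N)).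
move: wn wk; set n := N.+2 => wn wk.
have ge (p q : quat R) : `|p| <= r -> `|p - q| <= r * `|w - 1| -> `|g p - g q| <= e'.
  move=> pr pq; apply/ltW/gd => //; apply: (le_lt_trans pq).
  by rewrite mulrC -ltr_pdivlMr.
have w0 : w != 0 by rewrite -normr_eq0 w1 oner_neq0.
have nR : n%:R != 0 :> R by rewrite pnatr_eq0.
exists n, (fun k => (n%:R^-1 * r ^- k) *:
  \sum_(j < n) (w^-1 ^+ j) ^+ k * f (r *: w ^+ j)) => z zr zI.
pose u := r^-1 *: z.
pose W j := n%:R^-1 *: \sum_(k < n) (u * w^-1 ^+ j) ^+ k.
have u1 : `|u| <= 1.
  by rewrite normrZ gtr0_norm ?invr_gt0 // ler_pdivrMl // mulr1.
have uI : GRing.comm u I.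
  by apply/commr_sym; apply: comm_scale; exact/commr_sym.
have uw : GRing.comm u w by apply: slice_comm uI wI.
have uv : GRing.comm u w^-1 by exact: commrV.
have vn : w^-1 ^+ n = 1 by rewrite exprVn wn invr1.
have vk k : (0 < k < n)%N -> w^-1 ^+ k != 1.
  by move=> /wk; rewrite exprVn; apply: contra => /eqP/(congr1 GRing.inv); rewrite invrK invr1 => ->.
have W1 : \sum_(j < n) W j = 1.
  by rewrite /W -scaler_sumr weight_sum // -scalerMnr scalerMnl -mulr_natr mulVf // scale1r.
have Wp j : W j * (r *: w ^+ j - z) = ((r / n%:R) *: (1 - u ^+ n)) * w ^+ j.
  have -> : r *: w ^+ j - z = (1 - u * w^-1 ^+ j) * (r *: w ^+ j).
    rewrite mulrBl mul1r -mulrA -scalerAr -exprMn_comm; last first.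
      by apply/commr_sym/commrV.
    rewrite mulVr ?unitqE // expr1n -scalerAr mulr1 /u scalerA divff ?gt_eqF //.
    by rewrite scale1r.
  have uwn : (u * w^-1 ^+ j) ^+ n = u ^+ n.
    rewrite exprMn_comm; last exact: commrX.
    by rewrite -exprM mulnC exprM vn expr1n mulr1.
  have geo : (\sum_(k < n) (u * w^-1 ^+ j) ^+ k) * (1 - u * w^-1 ^+ j) = 1 - u ^+ n.
    rewrite -uwn; set y := u * _.
    have yc : GRing.comm (1 - y) (\sum_(k < n) y ^+ k).
      apply: commr_sum => k _; apply/commrX/commr_sym/commrB => //.
      exact: commr1.
    by rewrite -yc -(opprB y 1) mulNr -subrX1 opprB.
  rewrite /W -scalerAl mulrA geo -!scalerAl -scalerAr scalerA; congr (_ *: _).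
  exact: mulrC.
pose phi (s : R) := \sum_(j < n) W j * f (z + s *: (r *: w ^+ j - z)).
have phi0 : phi 0 = f z.
  rewrite /phi; under eq_bigr do rewrite scale0r addr0.
  by rewrite -mulr_suml W1 mul1r.
have phi1 : phi 1 = \sum_(k < n) z ^+ k * ((n%:R^-1 * r ^- k) *:
    \sum_(j < n) (w^-1 ^+ j) ^+ k * f (r *: w ^+ j)).
  rewrite /phi.
  under eq_bigr do rewrite scale1r (addrC z) subrK /W -scalerAl mulr_suml.
  rewrite -scaler_sumr exchange_big scaler_sumr; apply: eq_bigr => k _ /=.
  have -> : z = r *: u by rewrite scalerA divff ?gt_eqF // scale1r.
  rewrite exprZn -scalerAr -scalerAl scalerA -mulrA mulVf; last first.
    by rewrite expf_neq0 // gt_eqF.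
  rewrite mulr1 mulr_sumr; congr (_ *: _); apply: eq_bigr => j _.
  by rewrite exprMn_comm ?mulrA //; exact: commrX.
rewrite -phi1 -phi0 distrC.
apply: (@normq_mean_value _ phi (fun s =>
  \sum_(j < n) W j * ((r *: w ^+ j - z) * g (z + s *: (r *: w ^+ j - z))))).
  move=> s; rewrite in_itv /= => s01.
  have wjI j : GRing.comm (r *: w ^+ j) I.
    by apply/commr_sym; apply: comm_scale; apply: commrX; exact/commr_sym.
  have wzI j : GRing.comm (r *: w ^+ j - z) I.
    by apply/commr_sym; apply: commrB; apply/commr_sym.
  have -> : phi = \sum_(j < n) (fun x : R => W j * f (z + x *: (r *: w ^+ j - z))).
    by apply/funext => x; rewrite fct_sumE.
  apply: is_derive_sum => j; apply: is_derive_mulql.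
  apply: is_derive_line; apply: fg => //.
    by apply: normq_convex => //; rewrite normrZ gtr0_norm // normqX w1 expr1n mulr1.
  by apply/commr_sym; apply: commrD; [|apply: comm_scale]; apply/commr_sym.
move=> s; rewrite in_itv /= => /andP[s0 s1].
under eq_bigr do rewrite mulrA Wp -mulrA.
rewrite -mulr_sumr normqM normrZ.
have wn1 : w != 1 by rewrite -(expr1 w) wk.
have sb : `|\sum_(j < n) w ^+ j * g (z + s *: (r *: w ^+ j - z))| <= n%:R * e'.
  by apply: (circle_sum_bound fg) => //; rewrite s0 ltW.
have u2 : `|1 - u ^+ n| <= 2.
  apply: (le_trans (ler_normB _ _)); rewrite normq1 normqX.
  by rewrite [leRHS](_ : 2 = 1 + 1) // lerD2l exprn_ile1.
rewrite ger0_norm; last by rewrite divr_ge0 // ltW.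
have -> : e = r / n%:R * 2 * (n%:R * e') by rewrite /e'; field; rewrite nR gt_eqF.
apply: ler_pM => //; first by rewrite mulr_ge0 // divr_ge0 // ltW.
by rewrite ler_wpM2l // divr_ge0 // ltW.
Qed.

(** * Power series on a slice *)

Lemma slice_coef_bound (R : realType) (I : quat R) (r M : R) n
    (c : nat -> quat R) :
  I * I = -1 -> 0 < r ->
  (forall z : quat R, `|z| <= r -> GRing.comm z I ->
     `|\sum_(k < n) z ^+ k * c k| <= M) ->
  forall k, (k < n)%N -> r ^+ k * `|c k| <= M.
Proof.
move=> II r0 cM k kn.
have [N wN] := slice_root_of_unity II ltr01.
pose m := (maxn N n); have nm : (n <= m)%N by exact: leq_maxr.
have [w [wI w1 wm wk _]] := wN m (leq_maxl _ _).
have km : (k < m)%N by exact: leq_trans nm.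
have m0 : (0 < m)%N by exact: leq_ltn_trans km.
have x1 (l : nat) : (l < n)%N -> l != k -> w ^+ (m - k + l) != 1.
  move=> ln; rewrite neq_ltn => /orP[lk|kl].
    rewrite addnBAC 1?ltnW // -subnBA 1?ltnW // wk // subn_gt0.
    rewrite (leq_ltn_trans (leq_subr _ _) km) ltn_subrL m0 andbT subn_gt0.
    exact: lk.
  rewrite (_ : m - k + l = m + (l - k))%N; last first.
    by rewrite addnBA ?(ltnW kl) // addnBAC // ltnW.
  rewrite exprD wm mul1r wk // subn_gt0 kl (leq_ltn_trans (leq_subr _ _)) //.
  exact: leq_trans nm.
(* w^(m - k) stands for w^(-k). *)
have E : \sum_(j < m) (w ^+ (m - k)) ^+ j *
    (\sum_(l < n) (r *: w ^+ j) ^+ l * c l) = m%:R * (r ^+ k *: c k).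
  have -> : \sum_(j < m) (w ^+ (m - k)) ^+ j *
      (\sum_(l < n) (r *: w ^+ j) ^+ l * c l) =
      \sum_(l < n) (\sum_(j < m) (w ^+ (m - k + l)) ^+ j) * (r ^+ l *: c l).
    under eq_bigr do rewrite mulr_sumr.
    rewrite exchange_big; apply: eq_bigr => l _ /=.
    rewrite mulr_suml; apply: eq_bigr => j _.
    rewrite exprZn mulrA -scalerAr -scalerAl -scalerAr; congr (_ *: (_ * _)).
    rewrite (exprAC w j l) exprD exprMn_comm //.
    by apply: commrX; apply/commr_sym; apply: commrX.
  rewrite (bigD1 (Ordinal kn)) //= [X in _ + X]big1 ?addr0 => [|l lk].
    rewrite subnK ?(ltnW km) // wm; congr (_ * _).
    by under eq_bigr do rewrite expr1n; rewrite sumr_const card_ord.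
  rewrite sum_root_of_unity ?mul0r ?x1 ?ltn_ord //.
  by rewrite -exprM mulnC exprM wm expr1n.
have mR : 0 < m%:R :> R by rewrite ltr0n.
rewrite -(ler_pM2l mR).
have -> : m%:R * (r ^+ k * `|c k|) = `|m%:R * (r ^+ k *: c k)|.
  by rewrite !mulr_natl normrMn normrZ ger0_norm // exprn_ge0 // ltW.
rewrite -E; apply: (le_trans (ler_norm_sum _ _ _)).
apply: (@le_trans _ _ (\sum_(j < m) M)).
  apply: ler_sum => j _; rewrite normqM !normqX w1 !expr1n mul1r; apply: cM.
    by rewrite normrZ gtr0_norm // normqX w1 expr1n mulr1.
  by apply/commr_sym; apply: comm_scale; apply: commrX; exact/commr_sym.
by rewrite sumr_const card_ord mulr_natl.
Qed.

Lemma geometric_tail (R : realType) (x : R) n N :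
  0 <= x < 1 -> \sum_(n <= k < N) x ^+ k <= x ^+ n / (1 - x).
Proof.
move=> /andP[x0 x1]; have x1' : 0 < 1 - x by rewrite subr_gt0.
rewrite ler_pdivlMr // mulr_suml.
have [nN|Nn] := leqP n N; last by rewrite big_geq ?exprn_ge0 // ltnW.
have -> : \sum_(n <= k < N) x ^+ k * (1 - x) = x ^+ n - x ^+ N.
  under eq_bigr do rewrite mulrBr mulr1 -exprSr.
  rewrite (@telescope_sumr_eq _ _ _ (fun k => - x ^+ k)) // => [|k _].
    by rewrite opprK addrC.
  by rewrite opprK addrC.
by rewrite gerBl exprn_ge0.
Qed.

Lemma slice_taylor (R : realType) (I : quat R) (r : R) (f : quat R -> quat R) :
  I * I = -1 -> 0 < r ->
  (forall e, 0 < e -> exists n (c : nat -> quat R), forall z : quat R,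
    `|z| <= r -> GRing.comm z I -> `|f z - \sum_(k < n) z ^+ k * c k| <= e) ->
  exists (a : nat -> quat R) (K : R), (forall k, r ^+ k * `|a k| <= K) /\
    forall (z : quat R) n, `|z| < r -> GRing.comm z I ->
      `|f z - \sum_(k < n) z ^+ k * a k| <= K * ((`|z| / r) ^+ n / (1 - `|z| / r)).
Proof.
move=> II r0 fP.
have [M fM] : exists M, forall z : quat R, `|z| <= r -> GRing.comm z I -> `|f z| <= M.
  have [n [c h]] := fP 1 ltr01.
  exists (1 + \sum_(k < n) r ^+ k * `|c k|) => z zr zI.
  rewrite -[f z](subrK (\sum_(k < n) z ^+ k * c k)).
  apply: (le_trans (ler_normD _ _)); apply: lerD; first exact: h.
  apply: (le_trans (ler_norm_sum _ _ _)); apply: ler_sum => k _.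
  by rewrite normqM normqX ler_wpM2r // lerXn2r ?nnegrE // ltW.
have M0 : 0 <= M.
  apply: (le_trans (normr_ge0 (f 0))); apply: fM; first by rewrite normr0 ltW.
  exact/commr_sym/commr0.
(* The coefficients of each approximating polynomial are extended by 0, so that
   any sufficiently long partial sum represents it. *)
have /choice[C fC] m : exists c : nat -> quat R, exists n, forall N, (n <= N)%N ->
    forall z : quat R, `|z| <= r -> GRing.comm z I ->
    `|f z - \sum_(k < N) z ^+ k * c k| <= m.+1%:R^-1.
  have [|n [c h]] := fP m.+1%:R^-1; first by rewrite invr_gt0 ltr0n.
  exists (fun k => if (k < n)%N then c k else 0), n => N nN z zr zI.
  rewrite (_ : \sum_(k < N) _ = \sum_(k < n) z ^+ k * c k); first exact: h.
  rewrite (big_ord_widen _ (fun k => z ^+ k * c k) nN) [RHS]big_mkcond /=.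
  by apply: eq_bigr => k _; case: ifP => // _; rewrite mulr0.
have CB m k : r ^+ k * `|C m k| <= M + 1.
  have [n h] := fC m; apply: (@slice_coef_bound _ I r _ (maxn n k.+1)) => //; last first.
    by rewrite leq_max ltnSn orbT.
  move=> z zr zI; rewrite -[X in `|X|](subrK (f z)) addrC.
  apply: (le_trans (ler_normD _ _)); apply: lerD; first exact: fM.
  rewrite distrC; apply: (le_trans (h _ (leq_maxl _ _) z zr zI)).
  by rewrite invf_le1 ?ltr0n // ler1n.
have CC m l k : r ^+ k * `|C m k - C l k| <= m.+1%:R^-1 + l.+1%:R^-1.
  have [n h] := fC m; have [n' h'] := fC l.
  pose N := (maxn (maxn n n') k.+1).
  apply: (@slice_coef_bound _ I r _ N (fun k => C m k - C l k)) => //; last first.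
    by rewrite leq_max ltnSn orbT.
  move=> z zr zI; under eq_bigr do rewrite mulrBr.
  rewrite sumrB -[X in `|X|](subrKA (f z)).
  apply: (le_trans (ler_normD _ _)); apply: lerD.
    by rewrite distrC; apply: h; rewrite // !leq_max leqnn.
  by apply: h'; rewrite // !leq_max leqnn orbT.
have rk k : 0 < r ^+ k by rewrite exprn_gt0.
have small (e : R) : 0 < e -> exists m, forall l, (m <= l)%N -> l.+1%:R^-1 < e.
  move=> e0; exists (Num.truncn e^-1).+1 => // l ml.
  rewrite -[e]invrK ltf_pV2 ?posrE ?invr_gt0 ?ltr0n //.
  apply: (lt_le_trans (truncnS_gt _)); rewrite ler_nat; exact: leqW.
have cvC k : exists a, forall m, r ^+ k * `|C m k - a| <= 2 * m.+1%:R^-1.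
  have : cvgn (fun m => C m k).
    apply/cauchy_cvgP/cauchy_exP => e e0.
    have [|L hL] := small (e * r ^+ k / 2); first by rewrite divr_gt0 ?mulr_gt0.
    exists (C L k); exists L => // m /= Lm.
    rewrite -ball_normE /= -(ltr_pM2l (rk k)) (le_lt_trans (CC _ _ _)) //.
    rewrite mulrC [ltRHS](splitr (e * r ^+ k)); apply: ltrD; apply: hL.
      exact: leqnn.
    exact: Lm.
  move=> /cvg_ex[/= a Ca]; exists a => m; apply/ler_addgt0Pr => e e0.
  have e1 : 0 < e / r ^+ k by rewrite divr_gt0.
  have /cvgrPdist_lt /(_ _ e1) [L _ hL] := Ca.
  pose l := maxn L m.
  rewrite -[X in `|X|](subrKA (C l k)).
  apply: (@le_trans _ _ (r ^+ k * `|C m k - C l k| + r ^+ k * `|C l k - a|)).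
    by rewrite -mulrDr ler_wpM2l ?ler_normD // ltW.
  apply: lerD.
    apply: (le_trans (CC _ _ _)); rewrite mulrDl mul1r lerD2l.
    by rewrite lef_pV2 ?posrE ?ltr0n // ler_nat ltnS leq_maxr.
  rewrite mulrC -ler_pdivlMr // distrC ltW //; apply: hL; exact: leq_maxl.
have /choice[a aC] := cvC.
exists a, (M + 3); split=> [k|z n zr zI].
  rewrite -[a k](subrK (C 0%N k)); apply: (@le_trans _ _ (2 * 1%:R^-1 + (M + 1))).
    apply: (@le_trans _ _ (r ^+ k * `|a k - C 0%N k| + r ^+ k * `|C 0%N k|)).
      by rewrite -mulrDr ler_wpM2l // ?ler_normD // ltW.
    by apply: lerD; [rewrite distrC; exact: aC|exact: CB].
  by rewrite invr1; lra.
set x := `|z| / r.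
have x01 : 0 <= x < 1 by rewrite /x divr_ge0 ?(ltW r0) //= ltr_pdivrMr // mul1r.
have zx k y : `|z ^+ k * y| = x ^+ k * (r ^+ k * `|y|).
  by rewrite normqM normqX mulrA -exprMn /x divfK // gt_eqF.
have xk k : 0 <= x ^+ k <= 1.
  by rewrite exprn_ge0 ?exprn_ile1 //; case/andP: x01 => // ? /ltW.
apply/ler_addgt0Pr => e e0.
have [|m hm] := small (e / (1 + 2 * n%:R)).
  by rewrite divr_gt0 // ltr_pwDl // mulr_ge0.
have [n' h] := fC m; pose N := maxn n n'.
have -> : f z - \sum_(k < n) z ^+ k * a k = (f z - \sum_(k < N) z ^+ k * C m k)
    + \sum_(n <= k < N) z ^+ k * C m k + \sum_(k < n) z ^+ k * (C m k - a k).
  have -> : \sum_(k < n) z ^+ k * (C m k - a k) =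
      \sum_(k < n) z ^+ k * C m k - \sum_(k < n) z ^+ k * a k.
    by rewrite -sumrB; apply: eq_bigr => k _; rewrite mulrBr.
  have -> : \sum_(k < N) z ^+ k * C m k =
      \sum_(k < n) z ^+ k * C m k + \sum_(n <= k < N) z ^+ k * C m k.
    rewrite -!(big_mkord xpredT (fun k => z ^+ k * C m k)).
    by rewrite -big_cat_nat //= leq_maxl.
  set A := \sum_(k < n) z ^+ k * C m k; set B := \sum_(n <= k < N) _.
  by rewrite opprD !addrA !subrK.
apply: (@le_trans _ _ (m.+1%:R^-1 + (M + 1) * (x ^+ n / (1 - x)) + n%:R * (2 * m.+1%:R^-1))).
  apply: (le_trans (ler_normD _ _)); apply: lerD.
    apply: (le_trans (ler_normD _ _)); apply: lerD.
      by apply: h => //; [exact: leq_maxr|exact: ltW].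
    apply: (@le_trans _ _ ((M + 1) * \sum_(n <= k < N) x ^+ k)); last first.
      by rewrite ler_wpM2l ?addr_ge0 // geometric_tail.
    apply: (le_trans (ler_norm_sum _ _ _)); rewrite mulr_sumr; apply: ler_sum => k _.
    by rewrite zx mulrC ler_wpM2r ?CB //; case/andP: (xk k).
  apply: (le_trans (ler_norm_sum _ _ _)).
  apply: (@le_trans _ _ (\sum_(k < n) (2 * m.+1%:R^-1))).
    apply: ler_sum => k _; rewrite zx; apply: le_trans (aC k m).
    by rewrite ler_piMl ?mulr_ge0 // ?(ltW (rk k)) //; case/andP: (xk k).
  by rewrite sumr_const card_ord [leRHS]mulr_natl.
have : m.+1%:R^-1 * (1 + 2 * n%:R) <= e.
  rewrite -ler_pdivlMr; first by apply/ltW/hm.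
  by rewrite ltr_pwDl // mulr_ge0.
have : 0 <= x ^+ n / (1 - x).
  by case/andP: x01 => x0 x1; rewrite divr_ge0 ?exprn_ge0 // subr_ge0 ltW.
move: (x ^+ n / (1 - x)) (m.+1%:R^-1) (n%:R : R) => A B D.
nra.
Qed.

Lemma real_coef_eq0 (R : realType) (d : nat -> quat R) :
  (forall n, exists K e : R, 0 < e /\ forall t : R, 0 < t < e ->
     `|\sum_(k < n) (t *: 1) ^+ k * d k| <= K * t ^+ n) ->
  forall k, d k = 0.
Proof.
move=> dK k; elim/ltn_ind: k => k IH.
have [K [e [e0 h]]] := dK k.+1.
apply/eqP; rewrite -normr_le0; apply/ler_addgt0Pr => eps eps0; rewrite add0r.
have K1 : 0 < `|K| + 1 by rewrite ltr_pwDr.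
pose t := Num.min (e / 2) (eps / (`|K| + 1)).
have t0 : 0 < t by rewrite lt_min !divr_gt0.
have te : t < e by rewrite gt_min ltr_pdivrMr // ltr_pMr // ltr1n.
have := h t; rewrite t0 te => /(_ isT).
rewrite big_ord_recr /= big1 ?add0r => [|i _]; last by rewrite IH ?mulr0.
rewrite exprZn expr1n -scalerAl mul1r normrZ ger0_norm ?exprn_ge0 ?(ltW t0) //.
rewrite exprSr mulrCA ler_pM2l ?exprn_gt0 // => /le_trans; apply.
apply: (@le_trans _ _ ((`|K| + 1) * t)).
  by rewrite ler_wpM2r ?(ltW t0) // (le_trans (ler_norm _)) // lerDl.
by rewrite mulrC -ler_pdivlMr // ge_min lexx orbT.
Qed.

Lemma real_taylor_unique (R : realType) (f : quat R -> quat R)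
    (a b : nat -> quat R) (r s K L : R) : 0 < r -> 0 < s ->
  (forall (t : R) n, 0 < t < r -> `|f (t *: 1) - \sum_(k < n) (t *: 1) ^+ k * a k| <=
     K * ((t / r) ^+ n / (1 - t / r))) ->
  (forall (t : R) n, 0 < t < s -> `|f (t *: 1) - \sum_(k < n) (t *: 1) ^+ k * b k| <=
     L * ((t / s) ^+ n / (1 - t / s))) ->
  a = b.
Proof.
move=> r0 s0 fa fb; apply/funext => k; apply/subr0_eq.
apply: (@real_coef_eq0 _ (fun k => a k - b k)) => n.
have H (x t C : R) : 0 < x -> 0 < t < x / 2 ->
    C * ((t / x) ^+ n / (1 - t / x)) <= `|C| * 2 * x ^- n * t ^+ n.
  move=> x0 /andP[t0 tx]; have tx2 : t / x <= 2^-1.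
    by rewrite ler_pdivrMr // mulrC ltW.
  have h : 0 < 1 - t / x by lra.
  apply: (@le_trans _ _ (`|C| * ((t / x) ^+ n / (1 - t / x)))).
    rewrite ler_wpM2r ?ler_norm // divr_ge0 ?exprn_ge0 ?(ltW h) //.
    by rewrite divr_ge0 // ltW.
  have -> : `|C| * 2 * x ^- n * t ^+ n = `|C| * ((t / x) ^+ n * 2).
    by rewrite expr_div_n; ring.
  rewrite ler_wpM2l // ler_wpM2l ?exprn_ge0 ?divr_ge0 ?(ltW t0) ?(ltW x0) //.
  by rewrite -[leRHS]invrK lef_pV2 ?posrE //; lra.
exists (`|K| * 2 * r ^- n + `|L| * 2 * s ^- n), (Num.min (r / 2) (s / 2)).
split=> [|t /andP[t0]]; first by rewrite lt_min !divr_gt0.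
rewrite lt_min => /andP[tr ts].
have tr' : 0 < t < r by rewrite t0 (lt_trans tr) // ltr_pdivrMr // ltr_pMr // ltr1n.
have ts' : 0 < t < s by rewrite t0 (lt_trans ts) // ltr_pdivrMr // ltr_pMr // ltr1n.
under eq_bigr do rewrite mulrBr.
rewrite sumrB -[X in `|X|](subrKA (f (t *: 1))) mulrDl.
apply: (le_trans (ler_normD _ _)); apply: lerD.
  by rewrite distrC; apply: (le_trans (fa _ _ tr')); apply: H => //; rewrite t0.
by apply: (le_trans (fb _ _ ts')); apply: H => //; rewrite t0.
Qed.

Lemma slice_unit_exists (R : realType) (q : quat R) :
  exists2 I : quat R, I * I = -1 & GRing.comm q I.
Proof.
have [qr|qr] := pselect (is_real q); last first.
  by exists (iota_of q); [exact: iota_sqr|apply: comm_iota].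
exists qi; first by apply: quat_ext => /=; ring.
by case: q qr => t x y z [-> -> ->]; apply: quat_ext => /=; ring.
Qed.

Lemma sderivable_slice_taylor (R : realType) (rho : R) (f : quat R -> quat R)
    (I : quat R) (r : R) :
  C1_on [set q | `|q| < rho] f -> (forall q : quat R, `|q| < rho -> sderivable f q) ->
  I * I = -1 -> 0 < r < rho ->
  exists (a : nat -> quat R) (K : R), (forall k, r ^+ k * `|a k| <= K) /\
    forall (z : quat R) n, `|z| < r -> GRing.comm z I ->
      `|f z - \sum_(k < n) z ^+ k * a k| <= K * ((`|z| / r) ^+ n / (1 - `|z| / r)).
Proof.
move=> f1 fs II /andP[r0 rr]; apply: slice_taylor => // e e0.
apply: (@slice_poly_approx _ I r e f (fun q => 'D_1 f q)) => //.
  move=> q h qr qI hI; apply: is_derive_comm; first exact/fs/(le_lt_trans qr).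
  exact: slice_comm hI qI.
by move=> q qr; have [] := f1 1 (mem_head _ _) q (le_lt_trans qr rr).
Qed.

Lemma power_series_of_sderivable (R : realType) (rho : R) (f : quat R -> quat R) :
  0 < rho -> C1_on [set q | `|q| < rho] f ->
  (forall q : quat R, `|q| < rho -> sderivable f q) ->
  exists a : nat -> quat R, abs_power_series_on [set q | `|q| < rho] f a.
Proof.
move=> rho0 f1 fs.
have real_slice (I : quat R) (t : R) : GRing.comm (t *: 1) I.
  by apply/commr_sym; apply: comm_scale; exact: commr1.
have qi2 : qi * qi = -1 :> quat R by apply: quat_ext => /=; ring.
have [|a [K [_ aK]]] := sderivable_slice_taylor (r := rho / 2) f1 fs qi2.
  by rewrite divr_gt0 //= ltr_pdivrMr // ltr_pMr // ltr1n.
exists a => q /= qrho.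
have [I II qI] := slice_unit_exists q.
pose r := (`|q| + rho) / 2.
have qr : `|q| < r by rewrite /r midf_lt.
have rr : r < rho by rewrite /r midf_lt.
have r0 : 0 < r by exact: le_lt_trans qr.
have [|b [L [bL bT]]] := sderivable_slice_taylor (r := r) f1 fs II.
  by rewrite r0.
have -> : a = b.
  apply: (@real_taylor_unique _ f a b (rho / 2) r K L) => [||t n /andP[t0 tr]|t n /andP[t0 tr]] //.
  - by rewrite divr_gt0.
  - by have := aK (t *: 1) n; rewrite normrZ normq1 mulr1 gtr0_norm //; apply.
  - by have := bT (t *: 1) n; rewrite normrZ normq1 mulr1 gtr0_norm //; apply.
set x := `|q| / r in bT.
have x0 : 0 <= x by rewrite divr_ge0 // ltW.
have x1 : x < 1 by rewrite ltr_pdivrMr // mul1r.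
have nx1 : `|x| < 1 by rewrite ger0_norm.
have L0 : 0 <= L by apply: le_trans (bL 0%N); rewrite mulr_ge0 // exprn_ge0 // ltW.
split.
  apply: (@series_le_cvg _ _ (geometric L x)) => [k|k|k|]; rewrite /geometric //=.
  - by rewrite mulr_ge0 // exprn_ge0.
  - rewrite normqM normqX (_ : `|q| = x * r); last by rewrite /x divfK // gt_eqF.
    by rewrite exprMn -mulrA mulrC ler_wpM2r ?exprn_ge0.
  - exact: is_cvg_geometric_series.
apply/cvgrPdist_le => e e0.
have : geometric (L / (1 - x)) x @ \oo --> (0 : R) by exact: cvg_geometric.
move=> /cvgr0Pnorm_le /(_ e e0); apply: filterS => n /= h.
rewrite /series /= big_mkord (le_trans (bT q n qr qI)) //.
apply: le_trans h; rewrite (le_trans _ (ler_norm _)) //.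
by rewrite mulrA mulrAC.
Qed.

(** * S-derivability of power series *)

Lemma cvg_mulql (R : realType) (w l : quat R) (u : nat -> quat R) :
  u @ \oo --> l -> (fun n => w * u n) @ \oo --> w * l.
Proof.
move=> ul; apply/cvgrPdist_lt => e e0; near=> n.
rewrite -mulrBr normqM; apply: (@le_lt_trans _ _ ((`|w| + 1) * `|l - u n|)).
  by rewrite ler_wpM2r // lerDl.
have w1 : 0 < `|w| + 1 by rewrite ltr_pwDr.
rewrite -ltr_pdivlMl //; near: n; apply: cvgr_dist_lt => //.
by rewrite mulr_gt0 // invr_gt0.
Unshelve. all: by end_near. Qed.

Lemma derivative_power_bound (R : realType) (x d : R) k : 0 <= x -> 0 < d ->
  d * (k%:R * x ^+ k.-1) <= (x + d) ^+ k - x ^+ k.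
Proof.
move=> x0 d0; elim: k => [|k IH]; first by rewrite mul0r mulr0 subrr.
rewrite /= [(x + d) ^+ _]exprS [x ^+ k.+1]exprS.
have -> : d * (k.+1%:R * x ^+ k) = d * x ^+ k + x * (d * (k%:R * x ^+ k.-1)).
  case: k {IH} => [|k]; first by rewrite mul0r !mulr0 expr0 !mulr1 addr0.
  by rewrite /= exprS -(natr1 k.+1); ring.
have xd : x ^+ k <= (x + d) ^+ k by rewrite lerXn2r ?nnegrE ?addr_ge0 ?lerDl // ltW.
have := ler_wpM2l x0 IH; have := ler_wpM2l (ltW d0) xd.
move: (x ^+ k) ((x + d) ^+ k) => A B; lra.
Qed.

(* L k is the part of (q + h)^k linear in h, given by its recursion. Each other
   monomial of the expansion contains h at least twice, and replacing two of
   these h by d costs a factor (|h| / d)^2. *)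
Lemma power_remainder (R : realType) (q h : quat R) (L : nat -> quat R) (d : R) k :
  L 0%N = 0 -> (forall k, L k.+1 = L k * q + q ^+ k * h) ->
  0 < d -> `|h| <= d ->
  d ^+ 2 * `|(q + h) ^+ k - q ^+ k - L k| <= `|h| ^+ 2 * (`|q| + d) ^+ k.
Proof.
move=> L0 LS d0 hd; set x := `|q|; set Q := x + d.
have x0 : 0 <= x by exact: normr_ge0.
pose m k := k%:R * x ^+ k.-1.
have mS j : m j.+1 = m j * x + x ^+ j.
  rewrite /m; case: j => [|j]; first by rewrite !mul0r expr0 mulr1 add0r.
  by rewrite /= exprS -(natr1 j.+1); ring.
have m0 j : 0 <= m j by rewrite mulr_ge0 // exprn_ge0.
have Lm j : `|L j| <= `|h| * m j.
  elim: j => [|j IH]; first by rewrite L0 normr0 mulr_ge0 ?m0.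
  rewrite LS mS; apply: (le_trans (ler_normD _ _)).
  rewrite !normqM normqX -/x mulrDr mulrA; apply: lerD; last by rewrite mulrC.
  by rewrite ler_wpM2r.
pose e j := Q ^+ j - x ^+ j - d * m j.
have eS j : e j.+1 = e j * Q + d ^+ 2 * m j.
  by rewrite /e mS !exprS /Q; ring.
have e0 j : 0 <= e j by rewrite /e subr_ge0; exact: derivative_power_bound.
suff : d ^+ 2 * `|(q + h) ^+ k - q ^+ k - L k| <= `|h| ^+ 2 * e k.
  move=> /le_trans; apply; rewrite ler_wpM2l ?exprn_ge0 // /e -addrA gerDl.
  by rewrite -opprD oppr_le0 addr_ge0 ?exprn_ge0 // mulr_ge0 // ltW.
elim: k => [|k IH].
  by rewrite !expr0 subrr L0 subrr normr0 mulr0 mulr_ge0 ?exprn_ge0.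
have -> : (q + h) ^+ k.+1 - q ^+ k.+1 - L k.+1 =
    ((q + h) ^+ k - q ^+ k - L k) * (q + h) + L k * h.
  rewrite !exprSr LS; move: (L k) ((q + h) ^+ k) (q ^+ k) => u v w.
  by apply: quat_ext => /=; ring.
rewrite eS; apply: (@le_trans _ _ (d ^+ 2 * (`|(q + h) ^+ k - q ^+ k - L k| * Q + `|h| * m k * `|h|))).
  rewrite ler_wpM2l ?exprn_ge0 ?(ltW d0) //; apply: (le_trans (ler_normD _ _)).
  rewrite !normqM; apply: lerD; last by rewrite ler_wpM2r.
  by rewrite ler_wpM2l // (le_trans (ler_normD _ _)) // lerD2l.
have Q0 : 0 <= Q by rewrite addr_ge0 // ltW.
have := ler_wpM2r Q0 IH.
move: `|_ - _ - _| (m k) (e k) => A B C; nra.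
Qed.

Lemma abs_coef_series_bound (R : realType) (rho : R) (f : quat R -> quat R)
    (a : nat -> quat R) (r : R) :
  abs_power_series_on [set q | `|q| < rho] f a -> 0 <= r < rho ->
  exists2 M : R, 0 <= M & forall n, \sum_(k < n) r ^+ k * `|a k| <= M.
Proof.
move=> fa /andP[r0 rr]; have rq : `|r *: (1 : quat R)| = r.
  by rewrite normrZ normq1 mulr1 ger0_norm.
have [|+ _] := fa (r *: 1); first by rewrite /= rq.
move=> /cvg_seq_bounded/bounded_fun_has_ubound[M hM].
have E n : \sum_(k < n) r ^+ k * `|a k| <= M.
  apply: le_trans (hM _ (ex_intro2 _ _ n I erefl)).
  by rewrite /series /= big_mkord; under [leRHS]eq_bigr do rewrite normqM normqX rq.
by exists M => //; apply: le_trans (E 0%N); rewrite big_ord0.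
Qed.

Lemma power_series_quotient (R : realType) (rho : R) (f : quat R -> quat R)
    (a : nat -> quat R)
    (q : quat R) (L : quat R -> nat -> quat R) (l : quat R -> quat R) :
  abs_power_series_on [set q | `|q| < rho] f a -> 
  `|q| < rho -> (forall h, L h 0%N = 0) ->
  (forall h k, L h k.+1 = L h k * q + q ^+ k * h) ->
  (forall h, series (fun k => L h k * a k) @ \oo --> l h) ->
  h^-1 * (f (q + h) - f q - l h) @[h --> (0 : quat R)^'] --> (0 : quat R).
Proof.
move=> fa qr L0 LS Ll; pose d := (rho - `|q|) / 2.
have d0 : 0 < d by rewrite divr_gt0 // subr_gt0.
have dr : `|q| + d < rho by rewrite /d; lra.
have [|M M0 aM] := abs_coef_series_bound fa (r := `|q| + d).
  by rewrite dr andbT addr_ge0 // ltW.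
have d2 : 0 < d ^+ 2 by rewrite exprn_gt0.
have key h : `|h| <= d -> d ^+ 2 * `|f (q + h) - f q - l h| <= `|h| ^+ 2 * M.
  move=> hd.
  have qhr : `|q + h| < rho by rewrite (le_lt_trans (ler_normD _ _)) // (le_lt_trans _ dr) // lerD2l.
  have [_ c1] := fa _ qhr; have [_ c2] := fa _ qr.
  have c : `|\sum_(0 <= k < n) (q + h) ^+ k * a k - \sum_(0 <= k < n) q ^+ k * a k -
      \sum_(0 <= k < n) L h k * a k| @[n --> \oo] --> `|f (q + h) - f q - l h|.
    by apply: cvg_norm; apply: cvgB (Ll h); exact: cvgB.
  rewrite -ler_pdivlMl // -(cvg_lim _ c) //; apply: limr_le; first exact: cvgP c.
  near=> n; rewrite ler_pdivlMl // !big_mkord -!sumrB.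
  apply: (@le_trans _ _ (\sum_(k < n) `|h| ^+ 2 * ((`|q| + d) ^+ k * `|a k|))).
    apply: (@le_trans _ _ (d ^+ 2 * \sum_(k < n)
        `|(q + h) ^+ k * a k - q ^+ k * a k - L h k * a k|)).
      by rewrite ler_wpM2l ?(ltW d2) // ler_norm_sum.
    rewrite mulr_sumr; apply: ler_sum => k _.
    rewrite -!mulrBl normqM !mulrA ler_wpM2r //.
    exact: (power_remainder _ (L0 h) (LS h) d0 hd).
  by rewrite -mulr_sumr ler_wpM2l ?aM // exprn_ge0.
have M1 : 0 < M + 1 by rewrite ltr_wpDl.
apply/cvg0_dnbhsP => e e0; exists (Num.min d (e * d ^+ 2 / (M + 1))).
  by rewrite lt_min d0 /= divr_gt0 // mulr_gt0.
move=> h h0; rewrite lt_min => /andP[hd he].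
have hn : 0 < `|h| by rewrite normr_gt0.
rewrite normqM normqV ltr_pdivrMl // -(ltr_pM2l d2).
apply: (le_lt_trans (key h (ltW hd))).
rewrite expr2 -mulrA [ltRHS]mulrCA ltr_pM2l // mulrC.
apply: (@le_lt_trans _ _ ((M + 1) * `|h|)).
  by rewrite ler_wpM2r // lerDl.
by rewrite mulrC -ltr_pdivlMr // (mulrC _ e).
Unshelve. all: by end_near. Qed.

Lemma power_series_derivative (R : realType) (rho : R) (f : quat R -> quat R)
    (a : nat -> quat R) (q : quat R) :
  abs_power_series_on [set q | `|q| < rho] f a -> 
  `|q| < rho ->
  cvgn (series (fun k => (k%:R *: q ^+ k.-1) * a k)).
Proof.
move=> fa qr; pose d := (rho - `|q|) / 2.
have d0 : 0 < d by rewrite divr_gt0 // subr_gt0.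
have dr : `|q| + d < rho by rewrite /d; lra.
have [|M M0 aM] := abs_coef_series_bound fa (r := `|q| + d).
  by rewrite dr andbT addr_ge0 // ltW.
apply: normed_cvg; apply: nondecreasing_is_cvgn.
  by apply: nondecreasing_series => k _ _ /=; exact: normr_ge0.
exists (d^-1 * M) => _ [n _ <-].
change (\sum_(0 <= k < n) `|(k%:R *: q ^+ k.-1) * a k| <= d^-1 * M); rewrite big_mkord.
apply: (@le_trans _ _ (\sum_(k < n) d^-1 * ((`|q| + d) ^+ k * `|a k|))).
  apply: ler_sum => k _; rewrite normqM normrZ normqX normr_nat mulrA.
  rewrite ler_wpM2r // ler_pdivlMl //.
  apply: (le_trans (derivative_power_bound k (normr_ge0 q) d0)).
  by rewrite gerBl exprn_ge0.
by rewrite -mulr_sumr ler_wpM2l ?aM // invr_ge0 ltW.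
Qed.

Lemma differentiable_of_quotient (R : realType) (f l : quat R -> quat R)
    (q : quat R) (K : R) :
  linear l -> (forall h, `|l h| <= K * `|h|) ->
  h^-1 * (f (q + h) - f q - l h) @[h --> (0 : quat R)^'] --> (0 : quat R) ->
  differentiable f q.
Proof.
move=> l_lin lK /cvg0_dnbhsP fl.
pose l' : {linear quat R -> quat R} :=
  HB.pack l (GRing.isLinear.Build _ _ _ _ _ l_lin).
have lc : continuous l'.
  apply: bounded_linear_continuous; apply/bounded_funP => r; exists (`|K| * r) => h hr.
  apply: (le_trans (lK h)); apply: (@le_trans _ _ (`|K| * `|h|)).
    by rewrite ler_wpM2r // ler_norm.
  by rewrite ler_wpM2l.
have fE : f \o shift q = cst (f q) + l' +o_ (0 : quat R) id.
  apply/eqaddoP => _/posnumP[e].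
  have [|d d0 dl] := fl e%:num; first by [].
  apply/nbhs_ballP; exists d => //= h; rewrite -ball_normE /= sub0r normrN => hd.
  rewrite !fctE /= opprD addrA.
  have [->|h0] := eqVneq h 0.
    by rewrite add0r subrr sub0r normrN normr0 mulr0 (le_trans (lK _)) // normr0 mulr0.
  have := dl h h0 hd; rewrite normqM normqV ltr_pdivrMl ?normr_gt0 //.
  by rewrite (addrC h) mulrC => /ltW.
by apply/diff_locallyP; rewrite (diff_unique lc fE); split.
Qed.

Lemma iota_norm_le1 (R : realType) (q : quat R) : `|iota_of q| <= 1.
Proof.
rewrite /iota_of normrZ ger0_norm ?invr_ge0 //.
have [->|q0] := eqVneq (imq q) 0; first by rewrite normr0 mulr0.
by rewrite mulVf // normr_eq0.
Qed.

Lemma par_norm (R : realType) (q h : quat R) : `|par q h| <= `|h|.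
Proof.
rewrite /par normrZ ger0_norm // ler_pdivrMl // mulr_natl mulr2n.
apply: (le_trans (ler_normB _ _)); rewrite lerD2l !normqM.
have i1 := iota_norm_le1 q.
rewrite (@le_trans _ _ (`|iota_of q| * `|h|)) ?ler_piMr ?mulr_ge0 //.
by rewrite ler_piMl.
Qed.

Lemma perp_norm (R : realType) (q h : quat R) : `|perp q h| <= `|h|.
Proof.
rewrite /perp normrZ ger0_norm // ler_pdivrMl // mulr_natl mulr2n.
apply: (le_trans (ler_normD _ _)); rewrite lerD2l !normqM.
have i1 := iota_norm_le1 q.
rewrite (@le_trans _ _ (`|iota_of q| * `|h|)) ?ler_piMr ?mulr_ge0 //.
by rewrite ler_piMl.
Qed.

Lemma conj_decomp (R : realType) (q : quat R) :
  conjq q = (qt q)%:A - `|imq q| *: iota_of q.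
Proof.
rewrite {1}[q]quat_decomp /iota_of scalerA.
by apply: quat_ext => /=; ring.
Qed.

Lemma par_commute (R : realType) (q h : quat R) :
  ~ is_real q -> GRing.comm (par q h) q.
Proof.
move=> qr; have II := iota_sqr qr; rewrite [X in GRing.comm _ X]quat_decomp.
have pI : GRing.comm (par q h) (iota_of q).
  rewrite /par; move: (iota_of q) II => I II.
  have e1 : (h - I * h * I) * I = h * I + I * h.
    by rewrite mulrBl -[I * h * I * I]mulrA II mulrN1 opprK.
  have e2 : I * (h - I * h * I) = h * I + I * h.
    by rewrite mulrBr !mulrA II mulN1r mulNr opprK addrC.
  by rewrite /GRing.comm -scalerAl -scalerAr e1 e2.
by apply: commrD; apply: comm_scale => //; exact: commr1.
Qed.

Lemma perp_conj (R : realType) (q h : quat R) :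
  ~ is_real q -> q * perp q h = perp q h * conjq q.
Proof.
move=> qr; have II := iota_sqr qr.
have pI : iota_of q * perp q h = - (perp q h * iota_of q).
  rewrite /perp; move: (iota_of q) II => I II.
  have e1 : I * (h + I * h * I) = I * h - h * I.
    by rewrite mulrDr !mulrA II mulN1r mulNr.
  have e2 : (h + I * h * I) * I = - (I * h - h * I).
    by rewrite mulrDl -[I * h * I * I]mulrA II mulrN1 opprB.
  by rewrite -scalerAl -scalerAr e1 e2 scalerN opprK.
rewrite conj_decomp {1}[q]quat_decomp mulrDl mulrBr.
have -> : `|imq q| *: iota_of q * perp q h = `|imq q| *: (iota_of q * perp q h).
  by rewrite scalerAl.
have -> : perp q h * (`|imq q| *: iota_of q) = `|imq q| *: (perp q h * iota_of q).
  by rewrite scalerAr.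
rewrite pI scalerN; congr (_ - _).
by move: (perp q h) => p; apply: quat_ext => /=; ring.
Qed.

Lemma sub_conj_neq0 (R : realType) (q : quat R) :
  ~ is_real q -> q - conjq q != 0.
Proof.
apply: contra_not_neq => h.
have /= hx := congr1 (@qx R) h; have /= hy := congr1 (@qy R) h.
have /= hz := congr1 (@qz R) h.
by apply: quat_ext => /=; lra.
Qed.

Lemma comm_conj (R : realType) (q : quat R) : GRing.comm q (conjq q).
Proof. by apply: quat_ext => /=; ring. Qed.

Lemma derivative_power_rec (R : realType) (q : quat R) k :
  k.+1%:R *: q ^+ k = (k%:R *: q ^+ k.-1) * q + q ^+ k.
Proof.
case: k => [|k]; first by rewrite scale0r mul0r add0r scale1r.
by rewrite /= -scalerAl -exprSr -[in LHS](natr1 k.+1) scalerDl scale1r.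
Qed.

Lemma power_series_sderiv_real (R : realType) (rho : R) (f : quat R -> quat R)
    (a : nat -> quat R) (q : quat R) :
  abs_power_series_on [set q | `|q| < rho] f a -> `|q| < rho -> is_real q ->
  is_sderiv_real f q (limn (series (fun k => (k%:R *: q ^+ k.-1) * a k))).
Proof.
move=> fa qr /is_realP qreal.
have qc h : GRing.comm h q.
  by rewrite qreal; apply: comm_scale; exact: commr1.
apply: (power_series_quotient (L := fun h k => h * (k%:R *: q ^+ k.-1)) fa qr).
- by move=> h; rewrite scale0r mulr0.
- by move=> h k; rewrite derivative_power_rec mulrDr mulrA (commrX k (qc h)).
move=> h; have := @cvg_mulql _ h _ _ (power_series_derivative fa qr).
apply: cvg_trans; apply: near_eq_cvg; near=> n.
by rewrite /series /= mulr_sumr; apply: eq_bigr => k _; rewrite mulrA.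
Unshelve. all: by end_near. Qed.

Lemma power_series_sderiv_nonreal (R : realType) (rho : R) (f : quat R -> quat R)
    (a : nat -> quat R) (q : quat R) :
  abs_power_series_on [set q | `|q| < rho] f a -> `|q| < rho -> ~ is_real q ->
  is_sderiv_nonreal f q (limn (series (fun k => (k%:R *: q ^+ k.-1) * a k)))
    ((q - conjq q)^-1 * (f q - f (conjq q))).
Proof.
move=> fa qr qnr; set B := limn _; set w := q - conjq q.
have w0 : w \is a GRing.unit by rewrite unitqE sub_conj_neq0.
have wq : GRing.comm w q.
  by apply/commr_sym; apply: commrB => //; exact: comm_conj.
have wc : GRing.comm w (conjq q).
  by apply/commr_sym; apply: commrB => //; apply/commr_sym/comm_conj.
rewrite /is_sderiv_nonreal.
under eq_fun do rewrite -addrA -opprD.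
pose S k := w^-1 * (q ^+ k - conjq q ^+ k).
apply: (power_series_quotient (L := fun h k =>
  par q h * (k%:R *: q ^+ k.-1) + perp q h * S k) fa qr).
- by move=> h; rewrite scale0r /S !expr0 subrr !mulr0 addr0.
- move=> h k; rewrite derivative_power_rec.
  have -> : S k.+1 = S k * q + conjq q ^+ k.
    apply: (mulrI w0); rewrite mulrDr /S !mulrA !mulrV // !mul1r.
    rewrite mulrBl (commrX k wc) /w mulrBr -!exprSr.
    by rewrite addrA subrK.
  have -> : q ^+ k * h = par q h * q ^+ k + perp q h * conjq q ^+ k.
    rewrite -{1}(par_perp q h) mulrDr; congr (_ + _).
      by rewrite (commrX k (par_commute h qnr)).
    elim: k => [|k IH]; first by rewrite !expr0 mul1r mulr1.
    by rewrite exprSr -mulrA perp_conj // mulrA IH -mulrA -exprSr.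
  by rewrite !mulrDr mulrDl !mulrA addrACA.
move=> h; have cr : `|conjq q| < rho by rewrite normq_conj.
have [_ c1] := fa _ qr; have [_ c2] := fa _ cr.
have cB := @cvg_mulql _ (par q h) _ _ (power_series_derivative fa qr).
have cC := @cvg_mulql _ (perp q h) _ _
  (@cvg_mulql _ w^-1 _ _ (cvgB c1 c2)).
set T := series _.
have -> : T = (fun n => par q h * series (fun k => (k%:R *: q ^+ k.-1) * a k) n +
    perp q h * (w^-1 * (series (fun k => q ^+ k * a k) n -
                        series (fun k => conjq q ^+ k * a k) n))).
  apply/funext => n; rewrite /T /series /= -sumrB !mulr_sumr -big_split /=.
  by apply: eq_bigr => k _; rewrite /S -mulrBl !mulrA -mulrDl.
by apply: cvgD; [exact: cB|exact: cC].
Qed.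

Lemma sderivable_of_power_series (R : realType) (rho : R) (f : quat R -> quat R)
    (a : nat -> quat R) (q : quat R) :
  abs_power_series_on [set q | `|q| < rho] f a -> `|q| < rho -> sderivable f q.
Proof.
move=> fa qr.
have fd : differentiable f q.
  have [qreal|qnr] := pselect (is_real q).
    have fA := power_series_sderiv_real fa qr qreal.
    apply: differentiable_of_quotient fA => [c x y|h].
      by rewrite mulrDl scalerAl.
    by rewrite normqM mulrC.
  have fBC := power_series_sderiv_nonreal fa qr qnr.
  move: fBC; rewrite /is_sderiv_nonreal.
  set B := limn _; set C := _^-1 * _.
  under eq_fun do rewrite -addrA -opprD.
  apply: (@differentiable_of_quotient _ _ _ _ (`|B| + `|C|)) => [c x y|h].
    rewrite /par /perp; move: (iota_of q) B C => I B C.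
    by apply: quat_ext => /=; ring.
  apply: (le_trans (ler_normD _ _)); rewrite !normqM mulrDl.
  by rewrite ![_ * `|h|]mulrC lerD // ler_wpM2r ?par_norm ?perp_norm.
split=> //; first exact: differentiable_continuous.
- by move=> qreal; eexists; exact: power_series_sderiv_real fa qr qreal.
- by move=> qnr; do 2 eexists; exact: power_series_sderiv_nonreal fa qr qnr.
Qed.

Lemma perp_neq0 (R : realType) (q : quat R) :
  ~ is_real q -> exists h, perp q h != 0.
Proof.
move=> qnr; have II := iota_sqr qnr; apply: contrapT => noh.
have perp0 h : perp q h = 0.
  by apply: contrapT => /eqP hn0; apply: noh; exists h.
have cI h : GRing.comm h (iota_of q).
  have := par_perp q h; rewrite perp0 addr0 => <-.
  have /= -> : iota_of q = `|imq q|^-1 *: (q - (qt q)%:A).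
    by rewrite /iota_of; congr (_ *: _); apply: quat_ext => /=; ring.
  apply: comm_scale; apply: commrB; first exact: par_commute.
  by apply: comm_scale; exact: commr1.
move: (iota_of q) II cI => I II cI.
have := cI qi; have := cI qj; case: I II {cI} => t x y z.
rewrite /GRing.comm /GRing.mul /= => -[+ _ _ _] [h1 h2 h3 h4] [g1 g2 g3 g4].
have y0 : y = 0 by lra.
have z0 : z = 0 by lra.
have x0 : x = 0 by lra.
by rewrite x0 y0 z0 => h; have := sqr_ge0 t; rewrite expr2; lra.
Qed.

Lemma sderiv_nonreal_unique (R : realType) (f : quat R -> quat R)
    (q B C B' C' : quat R) : ~ is_real q ->
  is_sderiv_nonreal f q B C -> is_sderiv_nonreal f q B' C' -> C = C'.
Proof.
move=> qnr fBC fBC'; have [h h0] := perp_neq0 qnr.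
have [_ e1] := is_derive_sderiv_nonreal h fBC.
have [_ e2] := is_derive_sderiv_nonreal h fBC'.
move: e1; rewrite e2 (sderiv_nonreal_par qnr fBC) (sderiv_nonreal_par qnr fBC').
by move/addrI; move/(@mulrI _ (perp q h) h0).
Qed.

Theorem theorem2 (R : realType) (rho : R) (f : quat R -> quat R)
    (rho_gt0 : 0 < rho) (f_C1 : C1_on [set q | `|q| < rho] f) :
  ((forall q : quat R, `|q| < rho -> sderivable f q) <->
   (exists a : nat -> quat R, abs_power_series_on [set q | `|q| < rho] f a)) /\
  ((forall q : quat R, `|q| < rho -> sderivable f q) ->
   (forall q : quat R, `|q| < rho -> is_real q ->
      forall A : quat R, is_sderiv_real f q A -> A = 'D_1 f q) /\
   (forall q : quat R, `|q| < rho -> ~ is_real q ->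
      forall B C : quat R, is_sderiv_nonreal f q B C ->
        B = 'D_1 f q /\ C = (q - conjq q)^-1 * (f q - f (conjq q)))).
Proof.
split.
  split; first exact: power_series_of_sderivable.
  by move=> [a fa] q; exact: sderivable_of_power_series fa.
move=> fs; split=> [q _ _ A|q qr qnr B C fBC]; first exact: sderiv_real_val.
have [a fa] := power_series_of_sderivable rho_gt0 f_C1 fs.
split; first exact: sderiv_nonreal_par fBC.
exact: sderiv_nonreal_unique fBC (power_series_sderiv_nonreal fa qr qnr).
Qed.
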